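(* Let $D=D(a_1,\dots,a_m)$ be a standard diagram of a rational link, where $a_i\in\mathbb Z$, $a_i\neq0$ for all $i\in\{1,\dots,m\}$. Assume the following: 1. There is no $a_i$ equal to one. 2. There exists a large positive entry surrounded by positive entries. Precisely, there exists $j\in\{2,\dots,m-1\}$ such that $a_j\ge3$ and $a_{j-1},a_{j+1}>0$, or $a_1\ge3$ and $a_2>0$, or $a_m\ge3$ and $a_{m-1}>0$. 3. Any negative entry is surrounded by positive ones. Precisely, if $a_i<0$ with $i\in\{2,\dots,m-1\}$, then $a_{i-1},a_{i+1}>0$; if $a_1<0$ then $a_2>0$; and if $a_m<0$ then $a_{m-1}>0$. Then the rational link represented by $D$ has torsion of order two in its Khovanov homology.
   Context: Khovanov homology is the integral (bigraded) Khovanov homology $\bigoplus_{h,q}Kh^{h,q}(L)$. The conditions on the entries presuppose that the entries mentioned exist (so condition 2 presupposes $m\ge2$). Standard diagram $D(a_1,\dots,a_m)$ of a rational (2-bridge) link, with nonzero integers $a_i$: take four horizontal strands numbered $1,2,3,4$ from top to bottom. On the left, join the ends of strands $1,2$ and of strands $3,4$ by caps. From left to right insert $m$ horizontal twist regions: the $i$-th has $|a_i|$ crossings between the strands in positions $2,3$ if $i$ is odd and between those in positions $1,2$ if $i$ is even. On the right, join positions $1,2$ and $3,4$ by caps if $m$ is odd, and positions $2,3$ and $1,4$ by (nested) caps if $m$ is even. Sign convention: if $a_i>0$, the crossings of the $i$-th region are such that the $A$-smoothing of each of them gives two horizontal arcs (the $A$-smoothing joins the two regions swept by rotating the overstrand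 counterclockwise), for $i$ odd and for $i$ even alike; if $a_i<0$ the crossings are the opposite ones, so the $B$-smoothing gives two horizontal arcs. (Thus the link is the 2-bridge link associated, up to mirror image convention, with the continued fraction $a_1-\cfrac{1}{a_2-\cfrac{1}{\ddots-\frac1{a_m}}}$.) *)

(* Defs.v *)
From HB Require Import structures.
From mathcomp Require Import all_boot all_order all_algebra.
From mathcomp Require Import generic_quotient ring_quotient.
From mathcomp Require Import boolp.

Set Implicit Arguments.
Unset Strict Implicit.
Unset Printing Implicit Defensive.

Import GRing.Theory.
Local Open Scope ring_scope.

Definition cycle_pred (V W : zmodType) (g : {additive V -> W}) : pred V :=
  fun x => g x == 0.

Lemma cycle_zmod_closed (V W : zmodType) (g : {additive V -> W}) :
  zmod_closed (cycle_pred g).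
Proof.
split; first by rewrite unfold_in /cycle_pred raddf0.
move=> x y; rewrite !unfold_in /cycle_pred raddfB => /eqP-> /eqP->.
by rewrite subr0.
Qed.

HB.instance Definition _ (V W : zmodType) (g : {additive V -> W}) :=
  GRing.isZmodClosed.Build V (cycle_pred g) (cycle_zmod_closed g).

Record cycles (V W : zmodType) (g : {additive V -> W}) :=
  Cycle { cycle_val :> V; _ : cycle_pred g cycle_val }.

HB.instance Definition _ (V W : zmodType) (g : {additive V -> W}) :=
  [isSub for @cycle_val V W g].
HB.instance Definition _ (V W : zmodType) (g : {additive V -> W}) :=
  [Choice of cycles g by <:].
HB.instance Definition _ (V W : zmodType) (g : {additive V -> W}) :=
  [SubChoice_isSubZmodule of cycles g by <:].

Definition boundary_pred (U V W : zmodType)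
    (f : {additive U -> V}) (g : {additive V -> W}) : pred (cycles g) :=
  fun z => `[< exists w : U, f w = val z >].

Lemma boundary_zmod_closed (U V W : zmodType)
    (f : {additive U -> V}) (g : {additive V -> W}) :
  zmod_closed (boundary_pred f (g := g)).
Proof.
split; first by apply/asboolP; exists 0; rewrite !raddf0.
move=> x y /asboolP[u ux] /asboolP[v vy]; apply/asboolP; exists (u - v).
by rewrite !raddfB ux vy.
Qed.

HB.instance Definition _ (U V W : zmodType)
    (f : {additive U -> V}) (g : {additive V -> W}) :=
  GRing.isZmodClosed.Build (cycles g) (boundary_pred f (g := g))
    (boundary_zmod_closed f g).

(** [ker g / (ker g :&: im f)], which is the homology when [g \o f = 0]. *)
Definition homology (U V W : zmodType)
    (f : {additive U -> V}) (g : {additive V -> W}) : zmodType :=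
  Quotient.quot (GRing.ZmodClosed.clone (cycles g) (boundary_pred f (g := g)) _).

(** A link diagram is given by its planar diagram code.  A crossing is the list
    of the labels of the four edges meeting there, read counterclockwise from
    one of the two ends of the understrand: positions 0 and 2 are on the
    understrand, 1 and 3 on the overstrand.  Each edge label of a diagram occurs
    exactly twice.  Components without crossings cannot be encoded. *)
Definition diagram := seq (4.-tuple nat).

Definition crossing_of (D : diagram) := 'I_(size D).

(** The four ends at each crossing.  Positions are in ['I_4], seen as the
    integers modulo 4. *)
Definition end_of (D : diagram) := (crossing_of D * 'I_4)%type.

Definition edge (D : diagram) (p : end_of D) : nat :=
  tnth (tnth (in_tuple D) p.1) p.2.

(** Orientations: [o p] says that the strand leaves the crossing [p.1] at the
    end [p]. *)
Definition is_orientation (D : diagram) (o : {ffun end_of D -> bool}) : bool :=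
  [forall p : end_of D, o (p.1, p.2 + 2) != o p] &&
  [forall p : end_of D, forall q : end_of D,
     (p != q) && (edge p == edge q) ==> (o p != o q)].

(** A crossing is positive when turning the overstrand counterclockwise onto
    the understrand, across the regions between positions 1 and 2 and between
    positions 3 and 0, matches their directions. *)
Definition positive_crossing (D : diagram) (o : {ffun end_of D -> bool})
    (c : crossing_of D) : bool := o (c, 0) != o (c, 1).

Definition n_pos (D : diagram) (o : {ffun end_of D -> bool}) : nat :=
  #|[set c | positive_crossing o c]|.

Definition n_neg (D : diagram) (o : {ffun end_of D -> bool}) : nat :=
  #|[set c | ~~ positive_crossing o c]|.

(** A vertex of the cube of resolutions: [false] is the A-smoothing, which is
    the 0-smoothing, and [true] is the B-smoothing, which is the 1-smoothing. *)
Definition smoothing (D : diagram) := {ffun crossing_of D -> bool}.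

(** The A-smoothing connects positions 0-1 and 2-3, the B-smoothing connects
    positions 0-3 and 1-2. *)
Definition joined (D : diagram) (v : smoothing D) : rel (end_of D) :=
  fun p q => (edge p == edge q) ||
    ((p.1 == q.1) && (p.2 + q.2 == if v p.1 then 3 else 1)).

Definition same_circle (D : diagram) (v : smoothing D) : rel (end_of D) :=
  connect (joined v).

(** A labelling stands for the tensor product, over the circles, of elements of
    the basis 1, X of Z[X]/(X^2): a circle whose ends are labelled by [b] bears
    the factor X^b. *)
Definition labelling (D : diagram) := {ffun end_of D -> bool}.

Definition labels_circles (D : diagram) (v : smoothing D) (f : labelling D) :=
  [forall p, forall q, same_circle v p q ==> (f p == f q)].

Definition hdeg (D : diagram) (o : {ffun end_of D -> bool}) (v : smoothing D) :
    int :=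
  #|[set c | v c]|%:Z - (n_neg o)%:Z.

(** The degrees of 1 and X are 1 and -1; [roots] picks one end on each circle. *)
Definition qdeg (D : diagram) (o : {ffun end_of D -> bool}) (v : smoothing D)
    (f : labelling D) : int :=
  \sum_(p | roots (joined v) p) (if f p then -1 else 1)
  + #|[set c | v c]|%:Z + (n_pos o)%:Z - (n_neg o)%:Z *+ 2.

(** The basis of the chain group in bidegree [(h, q)]. *)
Definition generator (D : diagram) (o : {ffun end_of D -> bool}) (h q : int) :=
  {S : smoothing D * labelling D |
    [&& labels_circles S.1 S.2, hdeg o S.1 == h & qdeg o S.1 S.2 == q]}.

Definition chain (D : diagram) (o : {ffun end_of D -> bool}) (h q : int) :=
  {ffun generator o h q -> int}.

HB.instance Definition _ (D : diagram) (o : {ffun end_of D -> bool})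
  (h q : int) := GRing.Zmodule.on (chain o h q).

Definition near_crossing (D : diagram) (v : smoothing D) (c : crossing_of D)
    (p : end_of D) : bool := [exists k : 'I_4, same_circle v (c, k) p].

(** The edge of the cube at [c] starting from [v]: if the two arcs of the
    A-smoothing at [c] are on different circles, these are merged by the product
    X^a (x) X^b |-> X^(a+b); otherwise their circle is split by the coproduct
    1 |-> 1 (x) X + X (x) 1,  X |-> X (x) X.  This is the coefficient of the
    labelling [f'] of the target in the image of the labelling [f] of [v]. *)
Definition edge_coef (D : diagram) (c : crossing_of D) (v : smoothing D)
    (f f' : labelling D) : bool :=
  let p0 : end_of D := (c, 0) in
  let p2 : end_of D := (c, 2) in
  [forall p, near_crossing v c p || (f' p == f p)] &&
  (if same_circle v p0 p2 then (f' p0 + f' p2 == (f p0).+1)%N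
   else (f p0 + f p2 == f' p0)%N).

Definition edge_sign (D : diagram) (c : crossing_of D) (v : smoothing D) : int :=
  (-1) ^+ #|[set c' : crossing_of D | (c' < c)%N && v c']|.

Definition incidence (D : diagram) (S T : smoothing D * labelling D) : int :=
  \sum_(c | ~~ S.1 c && (T.1 == [ffun c' => (c' == c) || S.1 c']))
    (if edge_coef c S.1 S.2 T.2 then edge_sign c S.1 else 0).

(** The differential preserves [q] and raises [h] by one, so it is only used
    with [h' = h + 1]. *)
Definition differential (D : diagram) (o : {ffun end_of D -> bool})
    (q h h' : int) (x : chain o h q) : chain o h' q :=
  [ffun T => \sum_(S : generator o h q) x S * incidence (val S) (val T)].

Lemma differential_is_additive (D : diagram) (o : {ffun end_of D -> bool})
  (q h h' : int) : zmod_morphism (@differential D o q h h').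
Proof.
move=> x y; apply/ffunP => T; rewrite !ffunE -sumrB.
by apply: eq_bigr => S _; rewrite !ffunE mulrBl.
Qed.

HB.instance Definition _ (D : diagram) (o : {ffun end_of D -> bool})
  (q h h' : int) := GRing.isZmodMorphism.Build _ _
    (@differential D o q h h') (@differential_is_additive D o q h h').

Definition Kh (D : diagram) (o : {ffun end_of D -> bool}) (h q : int) :
    zmodType :=
  homology (@differential D o q (h - 1) h) (@differential D o q h (h + 1)).

(** A tangle built from left to right: [right_ends] lists, from top to bottom,
    the labels of the four strands at its right side, and [fresh] is a bound on
    the labels in use. *)
Record tangle := Tangle {
  crossings : diagram;
  right_ends : seq nat;
  fresh : nat
}.

Definition left_caps : tangle := Tangle [::] [:: 0; 0; 1; 1]%N 2%N.

(** Add on the right a crossing between the strands in positions [p] and [p.+1]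
    (counted from 0).  If [s] then the understrand goes from the lower left to
    the upper right end, so that the A-smoothing gives two horizontal arcs. *)
Definition add_crossing (p : nat) (s : bool) (t : tangle) : tangle :=
  let nw := nth 0%N (right_ends t) p in
  let sw := nth 0%N (right_ends t) p.+1 in
  let ne := fresh t in
  let se := (fresh t).+1 in
  let x := if s then [tuple sw; se; ne; nw] else [tuple nw; sw; se; ne] in
  Tangle (rcons (crossings t) x)
    (set_nth 0%N (set_nth 0%N (right_ends t) p ne) p.+1 se) (fresh t).+2.

Definition twist_region (i : nat) (ai : int) (t : tangle) : tangle :=
  iter `|ai|%N (add_crossing (if odd i then 1%N else 0%N) (0 < ai)) t.

Definition twisted (m : nat) (a : nat -> int) : tangle :=
  foldl (fun t i => twist_region i (a i) t) left_caps (iota 1 m).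

(** The closure on the right, as a renaming of the labels of [right_ends]. *)
Definition right_caps (m : nat) (e : seq nat) (x : nat) : nat :=
  let e1 := nth 0%N e 0 in let e2 := nth 0%N e 1 in
  let e3 := nth 0%N e 2 in let e4 := nth 0%N e 3 in
  if odd m
  then (if x == e2 then e1 else if x == e4 then e3 else x)
  else (if x == e3 then e2 else if x == e4 then e1 else x).

(** [D(a 1, ..., a m)], for [0 < m] and nonzero [a i]. *)
Definition rational_diagram (m : nat) (a : nat -> int) : diagram :=
  let t := twisted m a in
  [seq map_tuple (right_caps m (right_ends t)) x | x <- crossings t].

(* Main.v *)
Require Import Defs.
From mathcomp Require Import all_boot all_order all_algebra.
From mathcomp Require Import generic_quotient ring_quotient.
From mathcomp Require Import boolp.
From mathcomp Require Import zify ring.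

Set Implicit Arguments.
Unset Strict Implicit.
Unset Printing Implicit Defensive.

Import GRing.Theory Num.Theory.

(** Number the crossings of a diagram and let t be the last vertex of the cube
    of resolutions, where every crossing is B-smoothed. Suppose that no crossing
    joins a circle of t to itself. Then every edge of the cube that arrives at t
    is a comultiplication, whose image is the ideal generated by X_u + X_w,
    where u and w are the two circles at the crossing. So the homology in the
    top homological degree is the ring Z[X_u : u circle of t] modulo all X_u^2
    and all X_u + X_w.

    Suppose moreover that consecutive crossings c_0, ..., c_(n-1) join circles
    V_0, V_1, ..., V_n = V_0 of t, with n at least 3.  If n is odd, then going
    round this polygon gives X_(V_0) = - X_(V_0), hence 2 X_(V_0) = 0
    ([odd_polygon_torsion]).  If n is even, the torsion is one degree lower.
    Write s_i for t with c_i A-smoothed, and s_ij for t with c_i and c_j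
    A-smoothed.  The sum of the all-ones labellings of the s_i is a cycle z,
    multiplying it by X_(V_0) gives a cycle, and 2 X_(V_0) z is, up to sign,
    the boundary of the sum over i < j of the all-ones labellings of the s_ij.
    All these computations are telescoping sums ([even_polygon_torsion]).

    These classes do not vanish because of a parity argument
    ([even_boundary]).  Consider a vertex v all of whose incoming edges are
    comultiplications, and the q-degree in which the labellings of v have
    exactly one X.  The comultiplication of 1 has two terms and that of X has
    two X, so every boundary has an even sum of coefficients over v.  For the
    two classes above, with v = t and v = s_1, this sum is 1.

    All of this needs to know how the circles change with the smoothing.  The
    only topological input is [away_arc]: if the two B-arcs at a crossing lie
    on different circles, then A-smoothing that crossing merges them.  It is a
    handshake argument, and it needs each edge of the diagram to have two ends,
    which for rational diagrams is a count of labels ([rational_edges_twice]).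

    In a rational diagram, a region of a positive entry a_i is B-smoothed into
    vertical arcs, so consecutive crossings of the region enclose a small circle
    with two edges. Since a_i is not 1, each crossing of the region has such a
    small circle on one side, and this circle does not reach its other side
    ([bigon_circle]). A region of a negative entry is B-smoothed into two
    horizontal strands. One of them is closed up by an outer strand and by the
    vertical arcs of the two neighbouring regions, which are positive, and this
    circle meets each crossing of the region only once ([negative_noloop]). So t
    is as above. If a_j is at least 3 and its neighbours are positive, the same
    outer strand joins the leftmost and the rightmost arc of the region
    ([region_closes]), and the a_j crossings of this region form the desired
    polygon. *)

(** * Circles of a smoothing *)

(** The elements that precede their image are in bijection with those that
    follow it, and together they are everything. *)
Lemma involution_even (T : finType) (f : T -> T) (A : pred T) :
  involutive f -> (forall x, f x != x) -> (forall x, A x -> A (f x)) ->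
  ~~ odd #|A|.
Proof.
move=> fK fN fA.
have fAE x : A (f x) = A x.
  by apply/idP/idP => [/fA|/fA //]; rewrite fK.
pose B := [pred x | A x && (enum_rank x < enum_rank (f x))%N].
pose C := [pred x | A x && (enum_rank (f x) < enum_rank x)%N].
have BC : #|B| = #|C|.
  rewrite -(card_image (inv_inj fK) B); apply: eq_card => x.
  apply/imageP/idP => [[y]|]; rewrite !inE.
    by move=> /andP[Ay lt_y] ->; rewrite fK fAE Ay.
  by move=> /andP[Ax lt_x]; exists (f x); rewrite ?inE fK // fAE Ax.
rewrite -(cardID B A) oddD.
rewrite (_ : #|[predI A & B]| = #|B|); last first.
  by apply: eq_card => x; rewrite !inE /= /in_mem /= /in_mem /=; case: (A x).
rewrite (_ : #|[predD A & B]| = #|B|) ?addbb // BC; apply: eq_card => x.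
rewrite !inE /= /in_mem /=; case Ax: (A x);
  rewrite /= ?andbF // andbT -leqNgt leq_eqVlt.
rewrite (inj_eq val_inj) (inj_eq enum_rank_inj) (negPf (fN x)) /=.
by [].
Qed.

Section Smoothings.
Variable D : diagram.
Implicit Types (v : smoothing D) (c : crossing_of D) (p q r : end_of D).
Implicit Type f : labelling D.
Local Open Scope ring_scope.

Lemma ord4P (k : 'I_4) : [\/ k = 0, k = 1, k = 2 | k = 3].
Proof.
case: k => -[|[|[|[|k]]]] lt_k4 //;
  [constructor 1|constructor 2|constructor 3|constructor 4]; exact/val_inj.
Qed.

Definition arc_end (b : bool) (k : 'I_4) : 'I_4 := (if b then 3 else 1) - k.

Lemma arc_endK b : involutive (arc_end b).
Proof. by move=> k; rewrite /arc_end opprB addrC subrK. Qed.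

Lemma arc_end_neq b k : arc_end b k != k.
Proof. by case: b; case: (ord4P k) => ->. Qed.

Lemma arc_endE b (k l : 'I_4) :
  (k + l == if b then 3 else 1) = (l == arc_end b k).
Proof. by rewrite /arc_end [RHS]eq_sym subr_eq addrC eq_sym. Qed.

Lemma joined_sym v : symmetric (joined v).
Proof.
move=> p q; rewrite /joined eq_sym; congr (_ || _).
by rewrite eq_sym addrC; case: eqP => //= ->.
Qed.

Lemma same_sym v : connect_sym (joined v).
Proof. exact/sym_connect_sym/joined_sym. Qed.

Lemma same_refl v p : same_circle v p p.
Proof. exact: connect0. Qed.

Lemma same_trans v : transitive (same_circle v).
Proof. exact: connect_trans. Qed.

Lemma sameC v p q : same_circle v p q = same_circle v q p.
Proof. exact: same_sym. Qed.

Lemma same_edge v p q : edge p = edge q -> same_circle v p q.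
Proof. by move=> pq; apply: connect1; rewrite /joined pq eqxx. Qed.

Lemma same_arc v c k : same_circle v (c, k) (c, arc_end (v c) k).
Proof. by apply: connect1; rewrite /joined /= arc_endE !eqxx orbT. Qed.

Lemma same_left v p q r : same_circle v p q ->
  same_circle v p r = same_circle v q r.
Proof. by move=> /(same_connect (@same_sym v)) h; apply: h. Qed.

Lemma same_right v p q r : same_circle v p q ->
  same_circle v r p = same_circle v r q.
Proof. by move=> h; rewrite ![same_circle v r _]sameC; apply: same_left. Qed.

Lemma same_ind v (R : rel (end_of D)) : reflexive R -> transitive R ->
  (forall p q, edge p = edge q -> R p q) ->
  (forall c k, R (c, k) (c, arc_end (v c) k)) ->
  forall p q, same_circle v p q -> R p q.
Proof.
move=> Rr Rt Re Ra p q /connectP[s ps ->].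
elim: s p ps => //= r s IHs p /andP[pr rs]; apply: Rt (IHs _ rs).
case/orP: pr => [/eqP/Re//|/andP[/eqP e]]; rewrite arc_endE => /eqP e2.
by have := Ra p.1 p.2; rewrite -e2 {2}e -!surjective_pairing.
Qed.

Definition edges_twice :=
  forall p, #|[pred q : end_of D | edge q == edge p]| = 2%N.

Definition edge_mate p : end_of D :=
  odflt p [pick q | (q != p) && (edge q == edge p)].

Hypothesis D2 : edges_twice.

Lemma edge_mateP p : (edge_mate p != p) /\ edge (edge_mate p) = edge p.
Proof.
rewrite /edge_mate; case: pickP => [q /andP[qp /eqP]//|no_q].
by have := D2 p; rewrite (cardD1 p) !inE eqxx (eq_card0 no_q).
Qed.

Lemma edge_mate_uniq p q : edge q = edge p -> q != p -> q = edge_mate p.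
Proof.
move=> qp nqp; have [mp em] := edge_mateP p.
have := D2 p; rewrite (cardD1 p) !inE eqxx (cardD1 q) !inE qp eqxx nqp /=.
have [->//|nq] := eqVneq q (edge_mate p).
by rewrite (cardD1 (edge_mate p)) !inE em eqxx mp eq_sym nq.
Qed.

Lemma edge_mateK : involutive edge_mate.
Proof.
move=> p; have [mp em] := edge_mateP p.
by apply/esym/edge_mate_uniq; rewrite // eq_sym.
Qed.

Definition set_off v c : smoothing D := [ffun c' => (c' != c) && v c'].

(** The part of the smoothing that is common to both smoothings of [c]. *)
Definition joined_away v c : rel (end_of D) := fun p q =>
  (edge p == edge q) || [&& p.1 != c, p.1 == q.1 & q.2 == arc_end (v p.1) p.2].

Lemma away_sub v c p q : connect (joined_away v c) p q -> same_circle v p q.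
Proof.
apply: connect_sub => {}p {}q /orP[/eqP|/and3P[_ /eqP e /eqP e2]].
  exact: same_edge.
by rewrite [p]surjective_pairing [q]surjective_pairing -e e2; apply: same_arc.
Qed.

Lemma away_off v c : joined_away (set_off v c) c =2 joined_away v c.
Proof.
move=> p q; rewrite /joined_away ffunE.
by case: (p.1 =P c) => //= _; rewrite andbT.
Qed.

Lemma away_sub_off v c p q :
  connect (joined_away v c) p q -> same_circle (set_off v c) p q.
Proof. by move=> h; apply: (@away_sub _ c);
  rewrite (eq_connect (@away_off v c)). Qed.

(** A handshake argument.  Otherwise the component Q of (c, k) away from [c]
    contains no other end of [c].  Pairing the ends along edges shows that Q is
    even, and pairing its ends other than (c, k) along arcs shows that Q minus
    one element is even. *)
Lemma away_arc v c k : v c ->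
  (forall l, same_circle v (c, k) (c, l) -> l = k \/ l = arc_end true k) ->
  connect (joined_away v c) (c, k) (c, arc_end true k).
Proof.
move=> vc only; apply/contraT => not_conn.
pose Q := [pred q | connect (joined_away v c) (c, k) q].
have evQ : ~~ odd #|Q|.
  apply: (involution_even edge_mateK) => [p|p]; first by case: (edge_mateP p).
  move=> /= Qp; apply: connect_trans Qp (connect1 _); rewrite /joined_away.
  by case: (edge_mateP p) => _ ->; rewrite eqxx.
pose mate p : end_of D := (p.1, arc_end (v p.1) p.2).
have mateK : involutive mate.
  by move=> [c' l]; rewrite /mate /= arc_endK.
have mateN p : mate p != p.
  by case: p => c' l; rewrite /mate xpair_eqE eqxx /= arc_end_neq.
have: ~~ odd #|[predD1 Q & (c, k)]|.
  apply: (involution_even mateK mateN) => -[c' l] /=;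
    rewrite !inE /= => /andP[n Qp].
  have c'c : c' != c.
    apply/eqP => e; rewrite e in n Qp.
    case: (only l (away_sub Qp)) => el; first by rewrite el eqxx in n.
    by rewrite el (negPf not_conn) in Qp.
  rewrite /mate /= xpair_eqE (negPf c'c) /=.
  apply: connect_trans Qp (connect1 _); rewrite /joined_away /= c'c !eqxx.
  by rewrite orbT.
by move: evQ; rewrite (cardD1 (c, k)) {1}/in_mem /= connect0 /= => /negbNE ->.
Qed.

(** In the B-smoothing, ends 3 and 2 of [c] are on the circles of 0 and 1. *)
Definition near v c p := same_circle v (c, 0) p || same_circle v (c, 1) p.

Section Merge.
Variables (v : smoothing D) (c : crossing_of D).
Hypotheses (vc : v c) (nloop : ~~ same_circle v (c, 0) (c, 1)).
Let v' := set_off v c.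

Lemma same_03 : same_circle v (c, 0) (c, 3).
Proof. by have := same_arc v c 0; rewrite vc /arc_end subr0. Qed.

Lemma same_12 : same_circle v (c, 1) (c, 2).
Proof.
have := same_arc v c 1; rewrite vc /arc_end.
by rewrite (_ : 3 - 1 = 2 :> 'I_4) //; apply/eqP.
Qed.

Lemma off_arc k : same_circle v' (c, k) (c, arc_end true k).
Proof.
apply: away_sub_off; apply: away_arc => // l.
have nl : ~~ same_circle v (c, 1) (c, 0) by rewrite sameC.
have n2 r : same_circle v (c, 2) r = same_circle v (c, 1) r.
  by rewrite (same_left _ same_12).
have n3 r : same_circle v (c, 3) r = same_circle v (c, 0) r.
  by rewrite (same_left _ same_03).
have e3 : arc_end true 0 = 3 by exact/eqP.
have e2 : arc_end true 1 = 2 by exact/eqP.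
have e1 : arc_end true 2 = 1 by exact/eqP.
have e0 : arc_end true 3 = 0 by exact/eqP.
case: (ord4P k) => ->; case: (ord4P l) => ->; rewrite ?(e0, e1, e2, e3); auto;
rewrite ?(n2, n3) ?[same_circle v _ (c, 2)]sameC ?[same_circle v _ (c,
  3)]sameC ?(n2, n3)
 ?(negPf nloop) ?(negPf nl) //.
Qed.

Lemma off_joined : same_circle v' (c, 0) (c, 1).
Proof. by have := same_arc v' c 0; rewrite /v' ffunE eqxx /arc_end subr0. Qed.

Lemma on_off p q : same_circle v p q -> same_circle v' p q.
Proof.
move: p q; apply: same_ind;
  [exact: same_refl|exact: same_trans|exact: same_edge|].
move=> d k; case: (d =P c) => [->|/eqP ndc].
  by rewrite vc; apply: off_arc.
have := same_arc v' d k; rewrite {2}/v' ffunE.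
by rewrite ndc.
Qed.

Lemma near_off p : near v c p = same_circle v' (c, 0) p.
Proof.
apply/orP/idP => [[/on_off//|/on_off h]|].
  exact: same_trans off_joined h.
pose R p q := near v c p ==> near v c q.
suff: forall p q, same_circle v' p q -> R p q.
  by move=> /[apply]; rewrite /R /near same_refl => /orP.
apply: same_ind; first by move=> q; apply/implyP.
- by move=> r q s /implyP qr /implyP rs; apply/implyP => /qr/rs.
- move=> q r qr; apply/implyP; rewrite /near.
  by rewrite !(same_right _ (same_edge v qr)).
- move=> d k; case: (d =P c) => [->|/eqP ndc].
    apply/implyP => _; rewrite /near.
    have: forall l, near v c (c, l); last exact.
    move=> l; rewrite /near.
    by case: (ord4P l) => ->; rewrite ?same_refl ?same_12 ?same_03 ?orbT.
  rewrite ffunE ndc /R /near /=; apply/implyP.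
  by rewrite !(same_right _ (same_arc v d k)).
Qed.

(** Turning a crossing from B to A merges its two circles and changes nothing
    else. *)
Lemma same_off p q :
  same_circle v' p q = same_circle v p q || (near v c p && near v c q).
Proof.
apply/idP/orP => [|[/on_off//|]]; last first.
  by rewrite !near_off => /andP[/(same_left _) <-].
move=> pq; have [np|nnp] := boolP (near v c p).
  right; move: np; rewrite !near_off => h /=.
  by rewrite (same_trans h pq).
left; pose R p q := near v c p || same_circle v p q.
suff: R p q by rewrite /R (negPf nnp).
have Rr : reflexive R by move=> x; rewrite /R same_refl orbT.
have : R p q; last by [].
move: {nnp} p q pq; apply: same_ind => //.
- move=> y x z; rewrite /R => /orP[->//|xy] /orP[|yz].
    by rewrite /near -!(same_right _ xy) => ->.
  by rewrite (same_trans xy yz) orbT.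
- by move=> x y xy; rewrite /R same_edge ?orbT.
- move=> d k; case: (d =P c) => [->|/eqP ndc].
    suff nk : near v c (c, k) by rewrite /R nk.
    rewrite /near; case: (ord4P k) => ->;
      by rewrite ?same_refl ?same_12 ?same_03 ?orbT.
  by have := same_arc v d k; rewrite /R ffunE ndc => ->; rewrite orbT.
Qed.
End Merge.
End Smoothings.

Local Open Scope ring_scope.

(** * Chains and degrees *)

Lemma homology_torsion (U V W : zmodType) (f : {additive U -> V})
    (g : {additive V -> W}) (z : V) (w : U) :
  g z = 0 -> f w = z *+ 2 -> (forall u, f u <> z) ->
  exists x : homology f g, x != 0 /\ x *+ 2 = 0.
Proof.
move=> gz fw nb; have zP : cycle_pred g z by rewrite /cycle_pred gz.
pose B := GRing.ZmodClosed.clone (cycles g) (boundary_pred f (g := g)) _.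
have piE (y : cycles g) :
    (\pi_(Quotient.quot B)%qT y == 0) = boundary_pred f y.
  rewrite -[0](raddf0 (\pi_(Quotient.quot B)%qT)).
  by rewrite -Quotient.idealrBE subr0.
exists (\pi_(Quotient.quot B)%qT (Cycle zP)); split.
  by rewrite piE; apply/asboolP => -[u /nb].
rewrite -raddfMn; apply/eqP; rewrite piE; apply/asboolP; exists w.
by rewrite fw mulr2n.
Qed.

Section Complex.
Variables (D : diagram) (o : {ffun end_of D -> bool}).
Implicit Types (v : smoothing D) (c : crossing_of D) (p q r : end_of D).
Implicit Type f : labelling D.

Definition ncircles v := #|[pred p | roots (joined v) p]|.

(** The roots are one transversal of the circles, and any other is as large. *)
Lemma card_transversal v (P : pred (end_of D)) :
  (forall p q, P p -> P q -> same_circle v p q -> p = q) ->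
  (forall p, exists2 q, P q & same_circle v p q) ->
  #|P| = ncircles v.
Proof.
move=> inj cover; have symv := @same_sym _ v.
rewrite -(card_in_image (f := fingraph.root (joined v)) (A := P)); last first.
  by move=> p q Pp Pq /(fingraph.rootP symv)/inj -> .
apply: eq_card => p; rewrite !inE.
apply/imageP/idP => [[q _ ->]|/eqP rp]; first exact: roots_root.
have [q Pq pq] := cover p; exists q => //; rewrite -rp;
  exact/(fingraph.rootP symv).
Qed.

Definition one_label : labelling D := [ffun => false].
Definition X_label v r : labelling D := [ffun p => same_circle v r p].

Definition n_X v f := #|[pred p | roots (joined v) p & f p]|.
Definition n_on v := #|[set c | v c]|.

Lemma qdegE v f : qdeg o v f =
  (ncircles v)%:Z - (n_X v f)%:Z *+ 2 + (n_on v)%:Z + (n_pos o)%:Z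
    - (n_neg o)%:Z *+ 2.
Proof.
have cardZ (A : pred (end_of D)) : #|A|%:Z = \sum_(p | A p) 1.
  by rewrite -natz -sum1_card natr_sum.
rewrite /qdeg; do 3!congr (_ + _); rewrite /ncircles /n_X !cardZ.
rewrite /= -sumrMnl [X in _ = _ - X]big_mkcondr -sumrB;
  apply: eq_bigr => p _ /=.
by case: (f p).
Qed.

Lemma X_label_circles v r : labels_circles v (X_label v r).
Proof.
apply/'forall_forallP => p q; apply/implyP => pq.
by rewrite !ffunE (same_right r pq).
Qed.

Lemma one_label_circles v : labels_circles v one_label.
Proof. by apply/'forall_forallP => p q; rewrite !ffunE eqxx implybT. Qed.

Lemma labels_circlesE v f p q :
  labels_circles v f -> same_circle v p q -> f p = f q.
Proof. by move=> /'forall_forallP/(_ p q)/implyP h /h/eqP. Qed.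

Lemma n_X_one v : n_X v one_label = 0%N.
Proof. by apply: eq_card0 => p; rewrite !inE ffunE andbF. Qed.

Lemma n_X_X v r : n_X v (X_label v r) = 1%N.
Proof.
have symv := @same_sym _ v.
rewrite /n_X (eq_card (B := pred1 (fingraph.root (joined v) r))) ?card1 // => p.
rewrite !inE ffunE /same_circle -(root_connect symv) /roots.
by apply/andP/eqP => [[/eqP <- /eqP ->]|->]; rewrite ?(root_root symv) ?eqxx.
Qed.

(** A labelling with a single X is determined by the circle that bears it. *)
Lemma n_X1P v f : labels_circles v f -> n_X v f = 1%N ->
  exists r, f = X_label v r.
Proof.
move=> fv /mem_card1[r rE]; exists r; apply/ffunP => p; rewrite ffunE.
have symv := @same_sym _ v; pose rt := fingraph.root (joined v).
have rr : roots (joined v) r by have := rE r; rewrite !inE eqxx => /andP[].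
rewrite (@labels_circlesE v f p (rt p)) //; last exact: connect_root.
have := rE (rt p); rewrite !inE roots_root //= => ->.
rewrite /same_circle -(root_connect symv) -/rt.
by rewrite [in LHS]eq_sym -{1}(eqP rr) -/rt.
Qed.

Lemma n_on_off v c : v c -> n_on v = (n_on (set_off v c)).+1.
Proof.
move=> vc; rewrite /n_on (cardsD1 c) inE vc; congr (_.+1).
by apply: eq_card => d; rewrite !inE ffunE.
Qed.

Lemma ncircles_off v c : edges_twice D -> v c ->
  ~~ same_circle v (c, 0) (c, 1) -> ncircles v = (ncircles (set_off v c)).+1.
Proof.
move=> D2 vc nloop; have symv := @same_sym _ v;
  pose rt := fingraph.root (joined v).
have rtP p : same_circle v p (rt p) by apply: connect_root.
(* Roots for the old smoothing, minus one of the two circles that merge. *)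
pose P := [pred p | roots (joined v) p & p != rt (c, 1)].
rewrite -(@card_transversal (set_off v c) P).
- rewrite /ncircles (cardD1 (rt (c, 1))) inE roots_root //.
  by congr (_.+1); apply: eq_card => p; rewrite !inE andbC.
- have only0 p : P p -> near v c p -> p = rt (c, 0).
    move=> /andP[/eqP rp np1] /orP[|] /(fingraph.rootP symv);
      rewrite rp // => e.
    by rewrite /rt e eqxx in np1.
  move=> p q Pp Pq; rewrite same_off //
    => /orP[|/andP[/(only0 _ Pp)-> /(only0 _ Pq)->//]].
  by case/andP: Pp Pq => /eqP rp _ /andP[/eqP rq _] /(fingraph.rootP symv);
    rewrite rp rq.
- move=> p; have [e|ne] := eqVneq (rt p) (rt (c, 1)).
    exists (rt (c, 0)).
      rewrite /P /= roots_root //=;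
      apply: contra nloop => /eqP/(fingraph.rootP symv).
      exact.
    rewrite same_off //; apply/orP; right; rewrite /near rtP /= andbT.
    by apply/orP; right; apply/(fingraph.rootP symv).
  by exists (rt p); rewrite ?/P /= ?roots_root ?ne //; apply: on_off => //;
    apply: rtP.
Qed.

(** An edge of the cube is indexed by its source in the definition of the
    incidence, while adequacy is a condition at its target. *)
Lemma set_onP (u : smoothing D) v c :
  (~~ u c && (v == [ffun c' => (c' == c) || u c'])) =
    (v c && (u == set_off v c)).
Proof.
apply/andP/andP => [[uc /eqP->]|[vc /eqP->]]; rewrite !ffunE eqxx; split=> //;
  apply/eqP.
  by apply/ffunP => d; rewrite !ffunE; case: eqP => [->|]; rewrite ?(negPf uc).
by apply/ffunP => d; rewrite !ffunE; case: eqP => [->|].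
Qed.

Lemma incidence_off v c f f' : v c ->
  incidence (set_off v c, f) (v, f') =
  if edge_coef c (set_off v c) f f' then edge_sign c (set_off v c) else 0.
Proof.
move=> vc; rewrite /incidence (eq_bigl (pred1 c)) ?big_pred1_eq // => d /=.
rewrite set_onP; apply/andP/eqP => [[vd /eqP/ffunP/(_ d)]|->//].
by rewrite !ffunE eqxx vd /= andbT => /negbFE/eqP.
Qed.

Lemma incidence0 (u : smoothing D) v f f' : (forall c, v c ->
  u <> set_off v c) ->
  incidence (u, f) (v, f') = 0.
Proof.
move=> no; rewrite /incidence big_pred0 // => c; rewrite set_onP.
by apply/negP => /andP[/no + /eqP].
Qed.

Definition in_degree (h q : int) (S : smoothing D * labelling D) :=
  [&& labels_circles S.1 S.2, hdeg o S.1 == h & qdeg o S.1 S.2 == q].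

Definition basis_chain (h q : int) (S : smoothing D * labelling D) :
  chain o h q :=
  [ffun T => (val T == S)%:R].

Lemma differential_basis (h h' q : int) S (T : generator o h' q) :
  in_degree h q S ->
  differential h' (basis_chain h q S) T = incidence S (val T).
Proof.
move=> SP; rewrite ffunE (bigD1 (Sub S SP :
  generator o h q)) //= ffunE SubK eqxx mul1r.
rewrite big1 ?addr0 // => R; rewrite ffunE -val_eqE SubK => /negPf->.
by rewrite mul0r.
Qed.
End Complex.

(** * Edges of the cube *)

Section Split.
Variable D : diagram.
Hypothesis D2 : edges_twice D.
Implicit Types (p r s : end_of D) (f : labelling D).

Lemma X_label_same (v : smoothing D) r s :
  same_circle v r s -> X_label v r = X_label v s.
Proof. by move=> rs; apply/ffunP => p; rewrite !ffunE (same_left _ rs). Qed.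

Lemma X_label_inj (v : smoothing D) r s :
  X_label v r = X_label v s -> same_circle v r s.
Proof. by move=> /ffunP/(_ s); rewrite !ffunE same_refl. Qed.

(** The label X on the circles of [r] and [s], which may coincide: it then has
    only one X, while the product of X_r and X_s vanishes. *)
Definition XX_label (v : smoothing D) r s : labelling D :=
  [ffun p => same_circle v r p || same_circle v s p].

Variables (v : smoothing D) (c : crossing_of D).
Hypotheses (vc : v c) (nloop : ~~ same_circle v (c, 0) (c, 1)).

Lemma near_crossing_off p : near_crossing (set_off v c) c p = near v c p.
Proof.
rewrite near_off //; apply/existsP/idP => [[k ckp]|c0p]; last by exists 0.
apply: same_trans ckp.
have off1 := off_joined v c.
case: (ord4P k) => ->; [exact: same_refl|exact: off1| |].
- by apply: same_trans off1 _; apply: on_off => //; apply: same_12.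
- by apply: on_off => //; apply: same_03.
Qed.

Lemma edge_coef_off f f' : labels_circles v f' ->
  edge_coef c (set_off v c) f f' =
  [forall p, near v c p || (f' p == f p)] &&
  (f' (c, 0%R) + f' (c, 1%R) == (f (c, 0%R)).+1)%N.
Proof.
move=> f'v; rewrite /edge_coef.
have -> : same_circle (set_off v c) (c, 0) (c, 2).
  by rewrite -near_off // /near same_12 ?orbT.
rewrite (labels_circlesE f'v (same_12 vc)); congr (_ && _).
by apply: eq_forallb => p; rewrite near_crossing_off.
Qed.

Lemma near0 : near v c (c, 0). Proof. by rewrite /near same_refl. Qed.

(** The comultiplication 1 |-> X_0 + X_1. *)
Lemma edge_coef_one f' : labels_circles v f' ->
  (edge_coef c (set_off v c) (one_label D) f')%:R =
  (f' == X_label v (c, 0%R))%:R + (f' == X_label v (c, 1%R))%:R :> int.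
Proof.
move=> f'v; rewrite edge_coef_off // ffunE.
have neq : X_label v (c, 0) != X_label v (c, 1).
  by apply: contra nloop => /eqP/X_label_inj.
have nl : same_circle v (c, 1) (c, 0) = false by rewrite sameC; apply/negbTE.
have [->|n0] := eqVneq f' (X_label v (c, 0)).
  rewrite (negPf neq) addr0 !ffunE same_refl (negPf nloop) /= andbT.
  suff -> : [forall p, near v c p || (X_label v (c,
    0) p == one_label D p)] by [].
  by apply/forallP => p; rewrite !ffunE /near; case: same_circle => //=;
    rewrite orbT.
have [->|n1] := eqVneq f' (X_label v (c, 1)).
  rewrite add0r !ffunE same_refl nl /= andbT.
  suff -> : [forall p, near v c p || (X_label v (c,
    1) p == one_label D p)] by [].
  by apply/forallP => p; rewrite !ffunE /near; case: (same_circle _ (c, 1));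
    rewrite ?orbT.
rewrite addr0; case: andP => // -[/forallP away sum1].
have awayE p : ~~ near v c p -> f' p = false.
  by move=> np; have := away p; rewrite ffunE (negPf np) => /eqP.
exfalso; move: sum1; case e0: (f' (c, 0)); case e1: (f' (c, 1)) => // _.
  case/eqP: n0; apply/ffunP => p; rewrite ffunE.
  case s0: (same_circle v (c, 0) p); first by rewrite -(labels_circlesE f'v s0).
  case s1: (same_circle v (c, 1) p); first by rewrite -(labels_circlesE f'v s1).
  by rewrite awayE // /near s0 s1.
case/eqP: n1; apply/ffunP => p; rewrite ffunE.
case s1: (same_circle v (c, 1) p); first by rewrite -(labels_circlesE f'v s1).
case s0: (same_circle v (c, 0) p); first by rewrite -(labels_circlesE f'v s0).
by rewrite awayE // /near s0 s1.
Qed.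

Lemma XX_labelE f r s : labels_circles v f -> f r -> f s ->
  (forall p, ~~ same_circle v r p -> ~~ same_circle v s p -> f p = false) ->
  f = XX_label v r s.
Proof.
move=> fv fr fs away; apply/ffunP => p; rewrite ffunE.
case rp: (same_circle v r p); first by rewrite -(labels_circlesE fv rp).
case sp: (same_circle v s p); first by rewrite -(labels_circlesE fv sp).
by rewrite away ?rp ?sp.
Qed.

(** The comultiplication X |-> X_0 X_1. *)
Lemma edge_coef_X_near f' r : labels_circles v f' -> near v c r ->
  edge_coef c (set_off v c) (X_label (set_off v c) r) f' =
  (f' == XX_label v (c, 0) (c, 1)).
Proof.
move=> f'v nr; rewrite edge_coef_off //.
have XE p : X_label (set_off v c) r p = near v c p.
  by rewrite ffunE near_off // (same_left (q := r)) // -near_off.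
rewrite XE near0; apply/andP/eqP => [[/forallP away sum2]|->]; last first.
  split; last by rewrite !ffunE !same_refl orbT.
  by apply/forallP => p; rewrite XE ffunE eqxx orbT.
apply: XX_labelE => //.
- by move: sum2; case: (f' (c, 0)); case: (f' (c, 1)).
- by move: sum2; case: (f' (c, 0)); case: (f' (c, 1)).
- by move=> p n0 n1; have := away p;
  rewrite XE /near (negPf n0) (negPf n1) => /eqP.
Qed.

(** The comultiplication 1 |-> X_0 + X_1 on circles away from that of [r], so
    that X_r |-> X_r X_0 + X_r X_1. *)
Lemma edge_coef_X_far f' r : labels_circles v f' -> ~~ near v c r ->
  (edge_coef c (set_off v c) (X_label (set_off v c) r) f')%:R =
  (f' == XX_label v r (c, 0%R))%:R + (f' == XX_label v r (c, 1%R))%:R :> int.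
Proof.
move=> f'v nr; rewrite edge_coef_off //.
have r0 : same_circle v r (c, 0) = false.
  by apply: contraNF nr; rewrite sameC /near => ->.
have r1 : same_circle v r (c, 1) = false.
  by apply: contraNF nr; rewrite sameC /near => ->; rewrite orbT.
have nl : same_circle v (c, 1) (c, 0) = false by rewrite sameC; apply/negbTE.
have XE p : X_label (set_off v c) r p = same_circle v r p.
  by rewrite ffunE same_off // (negPf nr) orbF.
rewrite XE r0.
have [->|n0] := eqVneq f' (XX_label v r (c, 0)).
  have -> : (XX_label v r (c, 0) == XX_label v r (c, 1)) = false.
    by apply/eqP => /ffunP/(_ (c, 0)); rewrite !ffunE same_refl r0 nl.
  rewrite addr0 !ffunE same_refl r0 r1 (negPf nloop) /= andbT.
  suff -> : [forall p, near v c p || (XX_label v r (c,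
    0) p == X_label (set_off v c) r p)] by [].
  by apply/forallP => p; rewrite XE ffunE /near;
    case: (same_circle v (c, 0) p) => //=; rewrite orbF eqxx orbT.
have [->|n1] := eqVneq f' (XX_label v r (c, 1)).
  rewrite add0r !ffunE same_refl r0 r1 nl /= andbT.
  suff -> : [forall p, near v c p || (XX_label v r (c,
    1) p == X_label (set_off v c) r p)] by [].
  by apply/forallP => p; rewrite XE ffunE /near;
    case: (same_circle v (c, 1) p) => //=; rewrite ?orbT ?orbF ?eqxx ?orbT.
rewrite addr0; case: andP => // -[/forallP away sum1]; exfalso.
have awayE p : ~~ near v c p -> f' p = same_circle v r p.
  by move=> np; have := away p; rewrite XE (negPf np) => /eqP.
have f'r : f' r by rewrite awayE // same_refl.
case e0: (f' (c, 0)); move: sum1; rewrite e0; case e1: (f' (c, 1)) => // _.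
  case/eqP: n0; apply: XX_labelE => // p rp p0.
  case p1: (same_circle v (c, 1) p); first by rewrite -(labels_circlesE f'v p1).
  by rewrite awayE ?(negPf rp) // /near p1 orbF.
case/eqP: n1; apply: XX_labelE => // p rp p1.
case p0: (same_circle v (c, 0) p); first by rewrite -(labels_circlesE f'v p0).
by rewrite awayE ?(negPf rp) // /near p0.
Qed.

End Split.

Section NotBoundary.
Variables (D : diagram) (o : {ffun end_of D -> bool}).
Hypothesis D2 : edges_twice D.
Variables (v : smoothing D) (r0 : end_of D) (h h' q : int).
Hypothesis noloop : forall c, v c -> ~~ same_circle v (c, 0) (c, 1).
Hypotheses (hv : hdeg o v = h) (qv : qdeg o v (X_label v r0) = q).

Lemma X_in_degree r : in_degree o h q (v, X_label v r).
Proof.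
apply/and3P; split=> /=; [exact: X_label_circles|exact/eqP|].
by rewrite -qv !qdegE !n_X_X.
Qed.

Lemma sum_X r :
  \sum_(T : generator o h q | (val T).1 == v) ((val T).2 == X_label v r)%:R =
    1 :> int.
Proof.
rewrite (bigD1 (Sub _ (X_in_degree r) : generator o h q)) //= !eqxx.
rewrite big1 ?addr0 // => T /andP[/eqP Tv]; rewrite -val_eqE /= => neT.
case: eqP => // e; case/eqP: neT.
by rewrite [LHS]surjective_pairing Tv e.
Qed.

(** At a given vertex, the q-degree determines the number of X. *)
Lemma generator_one_X (T : generator o h q) : (val T).1 = v ->
  exists r, (val T).2 = X_label v r.
Proof.
case: T => -[u f] /= /and3P[/= uf _ /eqP qf] uv; rewrite uv in uf qf *.
apply: n_X1P => //.
have := qf; rewrite -qv !qdegE n_X_X.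
lia.
Qed.

(** Modulo 2, the sum of the coefficients over [v] is a functional on chains
    that kills boundaries: an edge arriving at [v] has two terms at the all-ones
    labelling, and none at other labellings, as its terms would have an X on two
    circles. *)
Lemma even_boundary (w : chain o h' q) :
  exists k, \sum_(T : generator o h q | (val T).1 == v) differential h w T
            = k *+ 2.
Proof.
under eq_bigr => T _ do rewrite ffunE.
rewrite exchange_big /=.
pose even_int (x : int) := exists k, x = k *+ 2.
apply: (big_ind even_int); first by exists 0.
  by move=> _ _ [k ->] [l ->]; exists (k + l); rewrite mulrnDl.
move=> S _; rewrite -mulr_sumr.
suff [k ->]: even_int (\sum_(T : generator o h q | (val T).1 == v)
                        incidence (val S) (val T)).
  by exists (x := w S * k); rewrite mulrnAr.
case: S => -[u f] SP; rewrite [val _]/=.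
have [c /andP[vc /eqP uc]|no] := pickP [pred c | v c && (u == set_off v c)];
  last first.
  exists 0; rewrite big1 // => -[[v' f'] TP] /= /eqP ->.
  by apply: incidence0 => c vc uc; have := no c; rewrite /= vc uc eqxx.
have nl := noloop vc.
have incE (T : generator o h q) : (val T).1 == v -> incidence (u, f) (val T) =
    (edge_coef c u f (val T).2)%:R * edge_sign c u.
  move=> /eqP Tv; rewrite [val T]surjective_pairing Tv uc incidence_off //.
  by case: edge_coef; rewrite ?mul1r ?mul0r.
rewrite (eq_bigr _ incE) -mulr_suml.
have Tlab (T : generator o h q) : (val T).1 = v -> labels_circles v (val T).2.
  by case: T => -[u' f'] /= /and3P[/= + _ _] <-.
(* The two terms of the comultiplication of 1 are both in this degree. *)
have [f1|nf1] := eqVneq f (one_label D).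
  exists (edge_sign c u).
  rewrite (eq_bigr (fun T : generator o h q =>
    ((val T).2 == X_label v (c, 0))%:R + ((val T).2 == X_label v (c, 1))%:R)).
    by rewrite big_split /= !sum_X mulrDl mul1r mulr2n.
  by move=> T /eqP Tv; rewrite f1 uc edge_coef_one // Tlab.
exists 0; rewrite big1 ?mul0r // => T /eqP Tv.
have [r Tr] := generator_one_X Tv.
(* Any X of f would give two circles labelled X, but [X_label v r] has one. *)
case coef: edge_coef => //; exfalso; move: coef.
rewrite uc edge_coef_off ?Tlab // Tr => /andP[/forallP away sum].
have uf : labels_circles u f by case/and3P: SP.
have f0 : f (c, 0) = false.
  move: sum; rewrite !ffunE; case r0' : (same_circle v r (c, 0)).
    by rewrite (same_left _ r0') (negPf nl); case: (f _).
  by case: same_circle; case: (f _).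
have nearf p : near v c p -> f p = false.
  by rewrite near_off // -uc => cp; rewrite -(labels_circlesE uf cp).
have near_r : near v c r.
  move: sum; rewrite f0 !ffunE /near ![same_circle v r _]sameC.
  by case: same_circle; case: same_circle.
case/eqP: nf1; apply/ffunP => p; rewrite [RHS]ffunE.
have [/nearf//|np] := boolP (near v c p).
have := away p; rewrite (negPf np) /= ffunE => /eqP <-.
apply: contraNF np => rp; move: near_r; rewrite /near.
by rewrite !(same_right _ rp).
Qed.

End NotBoundary.

(** * A polygon of circles gives torsion *)

(** The common shape of all the computations around the polygon. *)
Lemma alternating_telescope (F : nat -> int) n :
  \sum_(i < n) (-1) ^+ i * (F i + F i.+1) = F 0%N - (-1) ^+ n * F n.
Proof.
elim: n => [|n IHn]; first by rewrite big_ord0 mul1r subrr.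
by rewrite big_ord_recr /= IHn exprS; ring.
Qed.

Section Combinations.
Variables (D : diagram) (o : {ffun end_of D -> bool}) (h h' q : int).
Variables (I : finType) (P : pred I) (a : I -> int).
Variable S : I -> smoothing D * labelling D.

Definition combination : chain o h q :=
  [ffun T => \sum_(i | P i) a i * (val T == S i)%:R].

Lemma differential_combination (T : generator o h' q) :
  (forall i, P i -> in_degree o h q (S i)) ->
  differential h' combination T = \sum_(i | P i) a i * incidence (S i) (val T).
Proof.
move=> SP; rewrite ffunE.
under eq_bigr => R _ do rewrite ffunE big_distrl.
rewrite exchange_big; apply: eq_bigr => i Pi /=.
rewrite (bigD1 (Sub _ (SP i Pi) : generator o h q)) //= eqxx mulr1.
rewrite big1 ?addr0 // => R; rewrite -val_eqE /= => /negPf->.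
by rewrite mulr0 mul0r.
Qed.
End Combinations.

(** The crossings [c i] are consecutive for the numbering of the diagram, so
    that the signs of the cube alternate around the polygon. The left and right
    arcs of [c i] are on the circles of [V i] and [V i.+1], and the circles
    strictly between [V 0] and [V n] meet two crossings only: none of their
    crossings has a parallel one. *)
Section Polygon.
Variables (D : diagram) (o : {ffun end_of D -> bool}).
Hypothesis D2 : edges_twice D.
Let t : smoothing D := [ffun => true].
Hypothesis adequate : forall d, ~~ same_circle t (d, 0) (d, 1).
Variables (b n : nat) (c : nat -> crossing_of D).
Hypotheses (n3 : (3 <= n)%N) (cE : forall i, (i < n)%N ->
  c i = (b + i)%N :> nat).
Let V i : end_of D := (c (i %% n), 0).
Hypothesis cycV : forall i, (i < n)%N -> same_circle t (c i, 1) (V i.+1).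
Hypothesis small : forall i p, (0 < i < n)%N -> same_circle t (V i) p ->
  p \in [:: (c i, 0); (c i, 3); (c i.-1, 1); (c i.-1, 2)].

Let t1 d : t d. Proof. by rewrite ffunE. Qed.
Let s d := set_off t d.
Let s2 d e := set_off (s d) e.

Lemma c_inj i j : (i < n)%N -> (j < n)%N -> c i = c j -> i = j.
Proof. by move=> lti ltj /(congr1 val) /=; rewrite !cE // => /addnI. Qed.

Lemma VE i : (i < n)%N -> V i = (c i, 0).
Proof. by move=> lti; rewrite /V modn_small. Qed.

Lemma V_inj i j : (i < n)%N -> (j < n)%N -> same_circle t (V i) (V j) -> i = j.
Proof.
wlog lt_ij : i j / (i < j)%N => [wl lti ltj Vij|lti ltj].
  have [lt|lt|//] := ltngtP i j; first exact: wl.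
  by apply/esym; apply: wl => //; rewrite sameC.
rewrite sameC => /(@small j);
  rewrite (leq_ltn_trans _ lt_ij) // ltj => /(_ isT).
rewrite VE // !inE !xpair_eqE /= !andbT !andbF !orbF => /eqP/c_inj.
exact.
Qed.

Lemma near_polygon i r : (i < n)%N -> near t (c i) r =
  same_circle t (V i) r || same_circle t (V i.+1) r.
Proof. by move=> lti; rewrite /near -VE // (same_left _ (cycV lti)). Qed.

Lemma V_mod i : V i = V (i %% n).
Proof. by rewrite /V modn_mod. Qed.

Lemma V_eq_mod i j : same_circle t (V i) (V j) -> i = j %[mod n].
Proof.
have n0 : (0 < n)%N by apply: leq_trans n3.
by rewrite V_mod (V_mod j) => /V_inj; rewrite !ltn_mod; apply.
Qed.

Lemma sE d e : s d e = (e != d).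
Proof. by rewrite !ffunE andbT. Qed.

(** A loop at [c i] in [s (c j)] would be a crossing parallel to [c j], hence an
    edge of a polygon with two sides. *)
Lemma noloop_s i j : (i < n)%N -> (j < n)%N -> i != j ->
  ~~ same_circle (s (c j)) (c i, 0) (c i, 1).
Proof.
move=> lti ltj nij; rewrite /s same_off // (negPf (adequate _)) /=.
rewrite !near_polygon // -VE // !(same_right _ (cycV lti)).
apply/negP => /andP[/orP[]/V_eq_mod e1 /orP[]/V_eq_mod e2].
- by case/eqP: nij; move: e1; rewrite !modn_small.
- by case/eqP: nij; move: e1; rewrite !modn_small.
- have : j.+2 = j %[mod n] by rewrite -addn1 -modnDml e1 modnDml addn1 -e2.
  rewrite -addn2 -[X in _ = X %[mod _]]addn0 => /eqP;
    rewrite eqn_modDl mod0n modn_small //.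
- have : j.+2 = j.+1 %[mod n] by rewrite -addn1 -modnDml e1 modnDml addn1 -e2.
  rewrite -[j.+2]addn1 -[X in _ = X %[mod _]]addn0 => /eqP.
  by rewrite eqn_modDl mod0n modn_small // ltnW.
Qed.

(** A crossing other than [c 1] with both sides on the circles of [V 1] and
    [V 2] would be [c 2] because of its left side, and [c 0] because of its
    right side. *)
Lemma noloop_s1 d : s (c 1%N) d -> ~~ same_circle (s (c 1%N)) (d, 0) (d, 1).
Proof.
have lt1n : (1 < n)%N by apply: leq_trans n3.
rewrite sE => nd1; rewrite /s same_off //
  (negPf (adequate _)) /= !near_polygon //.
apply/negP => /andP[h0 h1].
have d2 : d = c 2%N.
  case/orP: h0 => /small; rewrite ?lt1n ?n3 => /(_ isT);
  by rewrite !inE !xpair_eqE /= !andbT !andbF ?orbF ?(negPf nd1) //= => /eqP.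
have n_gt0 : (0 < n)%N by apply: leq_trans n3.
case/orP: h1 => /small; rewrite ?lt1n ?n3 => /(_ isT);
  rewrite !inE !xpair_eqE /= !andbT !andbF ?orbF ?(negPf nd1) //= => /eqP.
by rewrite d2 => /c_inj; rewrite n3 n_gt0 => /(_ isT isT).
Qed.

Lemma card_below (d : crossing_of D) :
  #|[set e : crossing_of D | (e < d)%N]| = d.
Proof.
rewrite -sum1_card (eq_bigl (fun e : crossing_of D => (e < d)%N)).
  by rewrite -(big_ord_widen _ (fun _ => 1%N)) ?sum1_card ?card_ord // ltnW.
by move=> e; rewrite inE.
Qed.

Lemma sign_s d : edge_sign d (s d) = (-1) ^+ d.
Proof.
rewrite /edge_sign; congr (_ ^+ _); rewrite -[RHS]card_below.
apply: eq_card => e; rewrite !inE sE -val_eqE /=.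
by case: ltngtP.
Qed.

Lemma s2C d e : s2 d e = s2 e d.
Proof. by apply/ffunP => k; rewrite !ffunE !andbT andbC. Qed.

Lemma s2E d e k : s2 d e k = (k != e) && (k != d).
Proof. by rewrite ffunE sE. Qed.

Lemma sign_s2_lt (d e : crossing_of D) : (d < e)%N ->
  edge_sign d (s2 e d) = (-1) ^+ d.
Proof.
move=> lt_de; rewrite /edge_sign; congr (_ ^+ _); rewrite -[RHS]card_below.
apply: eq_card => k; rewrite !inE s2E.
case: (ltnP k d) => //= lt_kd.
by rewrite -!val_eqE /= !ltn_eqF // (ltn_trans lt_kd).
Qed.

(** The A-smoothed crossing [d] comes before [e], hence the extra sign. *)
Lemma sign_s2_gt (d e : crossing_of D) : (d < e)%N ->
  edge_sign e (s2 d e) = - (-1) ^+ e.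
Proof.
move=> lt_de; rewrite /edge_sign -[X in - (_ ^+ X)]card_below.
rewrite (cardsD1 d [set k : crossing_of D | (k < e)%N]) inE lt_de add1n exprS.
rewrite mulN1r opprK; congr (_ ^+ _); apply: eq_card => k.
rewrite !inE s2E; case: (k =P e) => [->|_] /=; first by rewrite ltnn !andbF.
by rewrite andbC.
Qed.

Lemma hdeg_s d : hdeg o (s d) = hdeg o t - 1.
Proof. by have := n_on_off (t1 d); rewrite /hdeg /n_on => ->; rewrite /s;
  lia. Qed.

Lemma hdeg_s2 d e : d != e -> hdeg o (s2 d e) = hdeg o t - 1 - 1.
Proof.
move=> nde; have se : s d e by rewrite sE eq_sym.
by have := n_on_off se; rewrite -(hdeg_s d) /hdeg /n_on => ->; rewrite /s2; lia.
Qed.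

Lemma on_top (v : smoothing D) : n_on v = n_on t -> v = t.
Proof.
move=> vt; apply/ffunP => d; rewrite ffunE.
have tT : [set d | t d] = setT by apply/setP => e; rewrite !inE t1.
have /eqP/setP/(_ d): [set d | v d] == setT.
  by rewrite -tT eqEcard -/(n_on v) -/(n_on t) vt leqnn andbT tT subsetT.
by rewrite !inE.
Qed.

Lemma on_s (v : smoothing D) : n_on t = (n_on v).+1 -> exists d, v = s d.
Proof.
move=> vt; have [d vd|all_on] := pickP (fun d => ~~ v d); last first.
  have e : v = t by apply/ffunP => d; rewrite ffunE; apply/negbNE;
    rewrite all_on.
  by move: vt; rewrite e; lia.
exists d; pose u : smoothing D := [ffun e => (e == d) || v e].
have vu : v = set_off u d.
  apply/ffunP => e; rewrite !ffunE.
  by have [->|] := eqVneq e d; rewrite //= (negPf vd).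
have ud : u d by rewrite ffunE eqxx.
rewrite vu; congr set_off; apply: on_top.
by rewrite vt vu -n_on_off.
Qed.

Lemma hdeg_top (v : smoothing D) : hdeg o v = hdeg o t -> v = t.
Proof. by move=> e; apply: on_top; move: e; rewrite /hdeg /n_on; lia. Qed.

Lemma hdeg_top1 (v : smoothing D) : hdeg o v = hdeg o t - 1 ->
  exists d, v = s d.
Proof. by move=> e; apply: on_s; move: e; rewrite /hdeg /n_on; lia. Qed.

(** The coefficient at [f] of the generator X on the circle of [V i]. *)
Definition chi (v : smoothing D) (f : labelling D) i : int :=
  (f == X_label v (V i))%:R.

Lemma V_next d i : (i < n)%N -> X_label (s d) (c i, 1) = X_label (s d) (V i.+1).
Proof. by move=> lti; apply/X_label_same/on_off; rewrite ?t1 ?adequate //;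
  apply: cycV. Qed.

Lemma incidence_s_one i f : (i < n)%N -> labels_circles t f ->
  incidence (s (c i), one_label D) (t, f) =
  (-1) ^+ (b + i) * (chi t f i + chi t f i.+1).
Proof.
move=> lti ft; rewrite incidence_off // sign_s cE // /chi VE //.
rewrite -(X_label_same (cycV lti)) -edge_coef_one ?adequate //.
by case: edge_coef; rewrite ?mulr1 ?mulr0.
Qed.

(** The opposite signs of the two terms are the anticommutation of the faces of
    the cube. *)
Lemma incidence_s2_one i j d f : (i < j < n)%N -> labels_circles (s d) f ->
  incidence (s2 (c i) (c j), one_label D) (s d, f) =
  (-1) ^+ (b + i) * (chi (s d) f i + chi (s d) f i.+1) *+ (d == c j)
  - (-1) ^+ (b + j) * (chi (s d) f j + chi (s d) f j.+1) *+ (d == c i).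
Proof.
case/andP=> lt_ij lt_jn fd; have lt_in := ltn_trans lt_ij lt_jn.
have nij : c i != c j.
  by apply/eqP => /(c_inj lt_in lt_jn) e; rewrite e ltnn in lt_ij.
have lt_cij : (c i < c j)%N by rewrite !cE // ltn_add2l.
have [e|ndj] := eqVneq d (c j).
  rewrite e in fd *; rewrite [c j == c i]eq_sym (negPf nij) subr0 mulr1n s2C.
  have sji : s (c j) (c i) by rewrite sE.
  rewrite incidence_off // -/(s2 (c j) (c i)) sign_s2_lt // cE // /chi VE //.
  rewrite -V_next // -edge_coef_one //; last by apply: noloop_s;
    rewrite // ltn_eqF.
  by case: edge_coef; rewrite ?mulr1 ?mulr0.
have [e|ndi] := eqVneq d (c i).
  rewrite e in fd *; rewrite mulr0n sub0r mulr1n.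
  have sij : s (c i) (c j) by rewrite sE eq_sym.
  rewrite incidence_off // -/(s2 (c i) (c j)) sign_s2_gt // cE // /chi VE //.
  rewrite -V_next // -edge_coef_one //; last by apply: noloop_s;
    rewrite // gtn_eqF.
  by case: edge_coef; rewrite ?mulr1 ?mulr0 ?oppr0 ?mulrN1 ?mulNr ?mulr1.
rewrite !mulr0n subr0 incidence0 // => e se /ffunP/(_ d).
by rewrite s2E ndi ndj ffunE sE eqxx andbF.
Qed.

Lemma qdeg_s d (r : end_of D) : qdeg o (s d) (one_label D) =
  qdeg o t (X_label t r).
Proof.
rewrite !qdegE n_X_one n_X_X (ncircles_off D2 (t1 d) (adequate d)).
by rewrite (n_on_off (t1 d)) /s; lia.
Qed.

Lemma qdeg_s2 d e (r : end_of D) : s d e ->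
  ~~ same_circle (s d) (e, 0) (e, 1) ->
  qdeg o (s2 d e) (one_label D) = qdeg o (s d) (X_label (s d) r).
Proof.
move=> de nl; rewrite !qdegE n_X_one n_X_X (ncircles_off D2 de nl).
by rewrite (n_on_off de) /s2; lia.
Qed.

Lemma qdeg_s_X d e (r r' : end_of D) :
  qdeg o (s d) (X_label (s d) r) = qdeg o (s e) (X_label (s e) r').
Proof.
rewrite !qdegE !n_X_X.
have -> : ncircles (s d) = ncircles (s e).
  apply: succn_inj; apply: etrans (ncircles_off D2 (t1 e) (adequate e)).
  exact/esym/ncircles_off.
have -> // : n_on (s d) = n_on (s e).
by apply: succn_inj; apply: etrans (n_on_off (t1 e)); apply/esym/n_on_off.
Qed.

Lemma Vn : V n = V 0%N. Proof. by rewrite /V modnn mod0n. Qed.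

Lemma sign_mul i (x : int) : (-1) ^+ b * ((-1) ^+ (b + i) * x) = (-1) ^+ i * x.
Proof. by rewrite mulrA -exprD addnA addnn -mul2n exprD exprM sqrrN !expr1n
  mul1r. Qed.

Lemma XX_label_right (v : smoothing D) r p p' :
  same_circle v p p' -> XX_label v r p = XX_label v r p'.
Proof. by move=> pp'; apply/ffunP => e; rewrite !ffunE (same_left _ pp'). Qed.

Lemma XX_labelC (v : smoothing D) r p : XX_label v r p = XX_label v p r.
Proof. by apply/ffunP => e; rewrite !ffunE orbC. Qed.

(** The coefficient at [f] of the product of X on the circle of [V 0] by X on
    the circle of [V i]: it vanishes at both ends of the polygon because
    X^2 = 0. *)
Definition psi (f : labelling D) i : int :=
  if (0 < i < n)%N then (f == XX_label t (V 0%N) (V i))%:R else 0.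

(** Around the polygon, the boundary of X_(V_0) at s_i is X_(V_0) times the sum
    of X_(V_i) and X_(V_i+1). *)
Lemma edge_coef_psi i f : (i < n)%N -> labels_circles t f ->
  (edge_coef (c i) (s (c i)) (X_label (s (c i)) (V 0%N)) f)%:R
  = psi f i + psi f i.+1.
Proof.
move=> lti ft; have n_gt0 : (0 < n)%N by apply: leq_trans n3.
have [near0|far0] := boolP (near t (c i) (V 0%N)).
  rewrite edge_coef_X_near // -VE // (XX_label_right _ (cycV lti)) /psi.
  move: near0; rewrite near_polygon // => /orP[] /V_eq_mod; rewrite mod0n.
    by rewrite modn_small // => i0; rewrite i0 /= add0r (leq_trans _ n3).
  have [lt_i1n|le_n] := ltnP i.+1 n; first by rewrite modn_small.
  have iE : i.+1 = n by apply/eqP; rewrite eqn_leq lti le_n.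
  have -> : (0 < i < n)%N by rewrite lti andbT -ltnS iE ltnW.
  by rewrite iE Vn andbF addr0 XX_labelC.
rewrite edge_coef_X_far // -VE // (XX_label_right _ (cycV lti)) /psi lti andbT.
move: far0; rewrite near_polygon // negb_or => /andP[n0 n1].
have i0 : i != 0%N by apply: contraNneq n0 => ->; apply: same_refl.
have i1 : i.+1 != n by apply: contraNneq n1 => ->; rewrite Vn; apply: same_refl.
have -> : (0 < i)%N by rewrite lt0n.
by have -> : (0 < i.+1 < n)%N by rewrite /= ltn_neqAle i1.
Qed.

(** In s_i the circles of V_i and V_(i+1) are merged. *)
Lemma chi_own i f : (i < n)%N -> chi (s (c i)) f i.+1 = chi (s (c i)) f i.
Proof.
move=> lti; rewrite /chi -V_next // VE //; congr (_ == _)%:R.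
by apply/esym/X_label_same/off_joined.
Qed.

(** The boundary of the sum of all s_ij, at s_l: a pair contributes when one of
    its two crossings is the [l]-th. *)
Lemma sum_pairs (A : nat -> int) (l : 'I_n) :
  \sum_(ij : 'I_n * 'I_n | (ij.1 < ij.2)%N)
     (A ij.1 *+ (l == ij.2) - A ij.2 *+ (l == ij.1)) =
  \sum_(i < l) A i - (\sum_(i < n) A i - \sum_(i < l.+1) A i).
Proof.
rewrite -(pair_big_dep predT (fun i j : 'I_n => (i < j)%N)
  (fun i j : 'I_n => A i *+ (l == j) - A j *+ (l == i))) /=.
under eq_bigr => i _ do rewrite sumrB.
rewrite sumrB; congr (_ - _).
  rewrite [RHS](big_ord_widen _ A (ltnW (ltn_ord l))) [RHS]big_mkcond.
  apply: eq_bigr => i _; rewrite big_mkcond (bigD1 l) //= eqxx big1 ?addr0 //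
    => j.
  by rewrite eq_sym => /negPf->; rewrite mulr0n if_same.
rewrite (bigD1 l) //= [X in _ + X]big1 ?addr0 => [|i]; last first.
  by rewrite eq_sym => /negPf il; apply: big1 => j _; rewrite il.
rewrite [X in _ - X](big_ord_widen _ A (ltn_ord l)).
rewrite [in RHS](bigID (fun j : 'I_n => (j < l.+1)%N)) /= addrC addrK.
by apply: eq_big => [j|j _]; rewrite ?eqxx // -ltnNge.
Qed.

(** In the top degree, the alternating sum of X_(V_i) + X_(V_i+1) is twice
    X_(V_0). *)
Lemma odd_polygon_torsion : odd n ->
  exists (h q : int) (x : Kh o h q), x != 0 /\ x *+ 2 = 0.
Proof.
move=> n_odd; pose h := hdeg o t; pose q := qdeg o t (X_label t (V 0%N)).
exists h, q.
pose w := combination o (h - 1) q predT (fun _ : 'I_n => (-1) ^+ b)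
   (fun i => (s (c i), one_label D)).
have z0 : in_degree o h q (t, X_label t (V 0%N)).
  exact: X_in_degree.
(* In turn: the top chain group has only cycles, w bounds twice the generator,
   and the generator is not a boundary. *)
apply: (@homology_torsion _ _ _ _ _ (basis_chain o h q (t,
  X_label t (V 0%N))) w).
- apply/ffunP => T; rewrite differential_basis // ffunE.
  rewrite [val T]surjective_pairing incidence0 // => d Td e.
  have := n_on_off Td; rewrite -e.
  have := max_card (mem [set d | (val T).1 d]); rewrite -/(n_on _).
  have -> : n_on t = #|crossing_of D|.
    by rewrite -cardsT; apply: eq_card => k; rewrite !inE t1.
  by move=> /leq_trans h1 h2; have := h1 _ (leqnn _); rewrite h2 ltnn.
- apply/ffunP => -[[v f] TP].
  have /and3P[/= fv /eqP /hdeg_top vt _] := TP; rewrite vt in fv.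
  rewrite differential_combination => [|i _]; last first.
    apply/and3P; split; [exact: one_label_circles|by rewrite /= hdeg_s|].
    by rewrite /= (qdeg_s _ (V 0%N)).
  rewrite [RHS]ffunMnE ffunE /= vt.
  under eq_bigr => i _ do rewrite incidence_s_one // sign_mul.
  rewrite alternating_telescope {2}/chi Vn -/(chi t f 0%N).
  by rewrite -signr_odd n_odd mulN1r opprK xpair_eqE eqxx mulr2n.
- move=> u du.
  have [k] := even_boundary D2 (fun d _ => adequate d) erefl (erefl q) u.
  rewrite du (eq_bigr (fun T :
    generator o h q => ((val T).2 == X_label t (V 0%N))%:R)).
    by rewrite (sum_X (h := h) erefl (erefl q)); lia.
  by move=> T /eqP Tt; rewrite ffunE [val T]surjective_pairing Tt xpair_eqE
    eqxx.
Qed.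

(** The class X_(V_0) z, where z is the sum of all s_i.  With the sign (-1)^i
    absorbed in X_(V_i), the boundary at s_l of the sum of all s_ij is
      (X_(V_0) - X_(V_l)) - (X_(V_l+1) - X_(V_n)),
    which is 2 X_(V_0), as X_(V_l) = - X_(V_l+1) in s_l with these signs. *)
Lemma even_polygon_torsion : ~~ odd n ->
  exists (h q : int) (x : Kh o h q), x != 0 /\ x *+ 2 = 0.
Proof.
(* The vertex s_1 serves to test non-vanishing: both circles at c_1 are small.
   *)
move=> n_even; pose h := hdeg o t - 1; pose s1 := s (c 1%N).
pose q := qdeg o s1 (X_label s1 (V 0%N)).
exists h, q.
pose X i := (s (c i), X_label (s (c i)) (V 0%N)).
pose x := combination o h q predT (fun _ : 'I_n => 1) (fun i => X i).
pose w := combination o (h - 1) q (fun ij : 'I_n * 'I_n => ij.1 < ij.2)%N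
  (fun _ => (-1) ^+ b) (fun ij => (s2 (c ij.1) (c ij.2), one_label D)).
have c_eq (i j : 'I_n) : (c i == c j) = (i == j).
  by apply/eqP/eqP => [/c_inj|-> //];
    move=> /(_ (ltn_ord i) (ltn_ord j))/val_inj.
have xP i : in_degree o h q (X i).
  apply/and3P; split=> /=; [exact: X_label_circles|by rewrite hdeg_s|].
  by rewrite /q (qdeg_s_X (c 1%N) (c i) (V 0%N) (V 0%N)).
have xE d f (T : generator o h q) : val T = (s d, f) ->
    x T = \sum_(i < n) chi (s d) f 0%N *+ (d == c i).
  move=> TE; rewrite ffunE; apply: eq_bigr => i _; rewrite mul1r TE xpair_eqE.
  have [->|nd] := eqVneq d (c i); first by rewrite eqxx.
  suff -> : (s d == s (c i)) = false by [].
  by apply/eqP => /ffunP/(_ d); rewrite !sE eqxx nd.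
(* In turn: x is a cycle, w bounds 2 x, and x is not a boundary. *)
apply: (@homology_torsion _ _ _ _ _ x w).
- apply/ffunP => -[[v f] TP].
  have /and3P[/= fv /eqP hv _] := TP.
  have vt : v = t by apply: hdeg_top; rewrite hv subrK.
  rewrite vt in fv.
  rewrite differential_combination // ffunE /=.
  have incE (i : 'I_n) : 1 * incidence (X i) (v, f) =
      (-1) ^+ b * ((-1) ^+ i * (psi f i + psi f i.+1)).
    have lti := ltn_ord i.
    rewrite mul1r vt incidence_off // sign_s cE // exprD.
    rewrite mulrA -[RHS]mulrC; set sg := _ ^+ _ * _.
    rewrite -[if _ then _ else _]/(if _ then sg else 0).
    suff <- : (edge_coef (c i) (set_off t (c i)) (X_label (s (c i)) (V 0%N))
      f)%:R
         = psi f i + psi f i.+1 by case: edge_coef; rewrite ?mul1r ?mul0r.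
    exact: edge_coef_psi.
  under eq_bigr => i _ do rewrite incE.
  rewrite -mulr_sumr alternating_telescope /psi /= ltnn andbF.
  by rewrite mulr0 subr0 mulr0.
- apply/ffunP => -[[v f] TP].
  have /and3P[/= fv /eqP /hdeg_top1[d vd] _] := TP; rewrite vd in fv.
  rewrite [RHS]ffunMnE (xE d f) //=; last by rewrite vd.
  rewrite differential_combination => [|[i j] /= lt_ij]; last first.
    have nij : c i != c j by rewrite c_eq; apply/eqP => e;
      rewrite e ltnn in lt_ij.
    apply/and3P; split; first exact: one_label_circles.
      by rewrite hdeg_s2.
    rewrite (qdeg_s2 (V 0%N)) ?sE 1?eq_sym ?noloop_s //.
      exact/eqP/qdeg_s_X.
    by apply: contra nij => /eqP->.
  rewrite /= vd; pose A i := (-1) ^+ i * (chi (s d) f i + chi (s d) f i.+1).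
  rewrite (eq_bigr (fun ij : 'I_n * 'I_n =>
    A ij.1 *+ (d == c ij.2) - A ij.2 *+ (d == c ij.1))); last first.
    move=> [i j] /= lt_ij; rewrite incidence_s2_one ?lt_ij //=.
    by rewrite mulrBr -!mulrnAr !sign_mul !mulrnAr.
  have [l /eqP dl|no_l] := pickP (fun l : 'I_n => d == c l); last first.
    by rewrite !big1 ?mul0rn // => [i _|ij _]; rewrite !no_l ?mulr0n ?subr0.
  rewrite dl (eq_bigr (fun ij : 'I_n * 'I_n =>
    A ij.1 *+ (l == ij.2) - A ij.2 *+ (l == ij.1))) => [|ij _];
      last by rewrite !c_eq.
  rewrite sum_pairs !alternating_telescope dl chi_own // [chi _ _ n]/chi Vn.
  rewrite -/(chi (s (c l)) f 0%N) -[(-1) ^+ n]signr_odd (negPf n_even).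
  rewrite (bigD1 l) //= eqxx big1 => [|i];
    first by rewrite exprS expr0 mulr1n; ring.
  by rewrite c_eq eq_sym => /negPf->.
- move=> u du.
  have [k] := even_boundary D2 noloop_s1 (hdeg_s _) (erefl q) u.
  rewrite du (eq_bigr (fun T : generator o h q =>
     ((val T).2 == X_label s1 (V 0%N))%:R)).
    by rewrite (sum_X (h := h) (hdeg_s _) (erefl q)); lia.
  move=> T /eqP Ts; rewrite (xE (c 1%N) (val T).2); last first.
    by rewrite [LHS]surjective_pairing Ts.
  have lt1n : (1 < n)%N by apply: leq_trans n3.
  rewrite (bigD1 (Ordinal lt1n)) //= eqxx big1 ?addr0 // => i.
  by rewrite -(inj_eq val_inj) /= eq_sym => ni;
    rewrite (c_eq (Ordinal lt1n)) -(inj_eq val_inj) /= (negPf ni).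
Qed.

End Polygon.

Local Close Scope ring_scope.

(** * Labels of a rational diagram *)

Definition program (m : nat) (a : nat -> int) : seq (nat * bool) :=
  flatten [seq nseq `|a i|%N (if odd i then 1 else 0,
    (0 < a i)%R) | i <- iota 1 m].

Definition build (pr : seq (nat * bool)) : tangle :=
  foldl (fun t x => add_crossing x.1 x.2 t) left_caps pr.

Lemma twistedE m a : twisted m a = build (program m a).
Proof.
rewrite /twisted /build /program; elim: (iota 1 m) left_caps => //= i s IHs t.
rewrite foldl_cat -IHs; congr foldl; rewrite /twist_region.
by elim: `|a i|%N t => //= k IHk t; rewrite -IHk -iterSr.
Qed.

Lemma programS m a : program m.+1 a =
  program m a ++ nseq `|a m.+1|%N (if odd m.+1 then 1 else 0, (0 < a m.+1)%R).
Proof.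
by rewrite /program -[in LHS](addn1 m) iotaD map_cat flatten_cat /= cats0 add1n.
Qed.

Lemma program_prefix m a j : j <= m -> exists s, program m a = program j a ++ s.
Proof.
elim: m => [|m IHm]; first by rewrite leqn0 => /eqP->; exists [::];
  rewrite cats0.
rewrite leq_eqVlt => /orP[/eqP->|/IHm[s ps]]; first by exists [::];
  rewrite cats0.
by rewrite programS ps -catA; eexists.
Qed.

Lemma nth_program m a j c : j < m ->
  size (program j a) <= c < size (program j.+1 a) ->
  nth (0, false) (program m a) c = (if odd j.+1 then 1 else 0, (0 < a j.+1)%R).
Proof.
move=> /(program_prefix a)[s ->] /andP[lec ltc].
rewrite nth_cat ltc programS nth_cat ltnNge lec /= nth_nseq.
by move: ltc; rewrite programS size_cat size_nseq -ltn_subLR // => ->.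
Qed.

Lemma program_region m a c : c < size (program m a) ->
  exists2 j, j < m & size (program j a) <= c < size (program j.+1 a).
Proof.
elim: m => [|m IHm]; first by rewrite /program.
case: (ltnP c (size (program m a))) => [/IHm[j lt_jm jc] _|le lt].
  by exists j => //; apply: leq_trans lt_jm _.
by exists m => //; rewrite le.
Qed.

Lemma program_pos m a x : x \in program m a -> x.1 <= 1.
Proof.
by case/flattenP => s /mapP[i _ ->] /nseqP[-> _] /=; case: odd.
Qed.

Section Build.
Variable pr : seq (nat * bool).
Hypothesis pr1 : forall x, x \in pr -> x.1 <= 1.

Definition right_at c := right_ends (build (take c pr)).

Lemma build_rcons s x : build (rcons s x) = add_crossing x.1 x.2 (build s).
Proof. by rewrite /build -cats1 foldl_cat. Qed.

Lemma fresh_build s : fresh (build s) = (size s).*2.+2.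
Proof. by elim/last_ind: s => // s x IHs;
  rewrite build_rcons size_rcons /= IHs. Qed.

Lemma size_build s : size (crossings (build s)) = size s.
Proof. by elim/last_ind: s => // s x IHs;
  rewrite build_rcons /= !size_rcons IHs. Qed.

(** The labels at the crossing added after [c] others to strands labelled by
    [e].  The two caps took the labels 0 and 1, and each crossing takes two. *)
Definition crossing_labels (x : nat * bool) (e : seq nat) (c : nat) : seq nat :=
  let nw := nth 0 e x.1 in let sw := nth 0 e x.1.+1 in
  let ne := c.*2.+2 in let se := c.*2.+3 in
  if x.2 then [:: sw; se; ne; nw] else [:: nw; sw; se; ne].

Lemma nth_build x0 c : c < size pr ->
  nth x0 (crossings (build pr)) c =
  crossing_labels (nth (0, false) pr c) (right_at c) c :> seq nat.
Proof.
rewrite /right_at; elim/last_ind: pr => // s x IHs.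
rewrite size_rcons ltnS leq_eqVlt build_rcons /= !nth_rcons size_build -cats1.
case/orP => [/eqP->|lt_cs]; last by rewrite lt_cs IHs // takel_cat // ltnW.
by rewrite ltnn eqxx take_size_cat // fresh_build /crossing_labels; case: x.2.
Qed.

Lemma right_at_next c : c < size pr ->
  right_at c.+1 = let x := nth (0, false) pr c in
    set_nth 0 (set_nth 0 (right_at c) x.1 c.*2.+2) x.1.+1 c.*2.+3.
Proof.
move=> lt_c; rewrite /right_at (take_nth (0,
  false)) // build_rcons /= fresh_build.
by rewrite size_take lt_c.
Qed.

Definition labels (t : tangle) :
  seq nat := flatten [seq val x | x <- crossings t].

(** Adding a crossing moves two right ends to the crossing and gives two new
    labels, each occurring once at the crossing and once on the right. *)
Lemma count_add_crossing p s t e1 e2 e3 e4 z : p <= 1 ->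
  right_ends t = [:: e1; e2; e3; e4] ->
  (count_mem z (labels (add_crossing p s t))
     + count_mem z (right_ends (add_crossing p s t)) =
   count_mem z (labels t) + count_mem z (right_ends t) +
   ((fresh t == z) + ((fresh t).+1 == z)).*2)%N.
Proof.
rewrite /labels /= map_rcons flatten_rcons count_cat => + ->.
by case: p => [|[|//]] _; case: s => /=; lia.
Qed.

Lemma build_inv s : (forall x, x \in s -> x.1 <= 1) ->
  size (right_ends (build s)) = 4 /\
  forall z,
    (count_mem z (labels (build s)) + count_mem z (right_ends (build s)) =
     (z < fresh (build s)).*2)%N.
Proof.
elim/last_ind: s => [_|s x IHs s1]; first by split=> // -[|[|z]].
have [|sz cnt] := IHs; first by move=> y ys; apply: s1;
  rewrite mem_rcons inE ys orbT.
have x1 : x.1 <= 1 by apply: s1; rewrite mem_rcons mem_head.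
rewrite build_rcons; split.
  by rewrite /= !size_set_nth sz; move: x1; case: x.1 => [|[|]].
case Re : (right_ends (build s)) sz => [|e1 [|e2 [|e3 [|e4 [|]]]]] // _ z.
rewrite (count_add_crossing _ _ x1 Re) cnt /=.
by lia.
Qed.

(** The two left caps put equal labels at positions 0, 1 and at positions 2, 3.
    The first crossing, in the middle, breaks both pairs. *)
Lemma right_ends_uniq s : (forall x, x \in s -> x.1 <= 1) -> s <> [::] ->
  (head (0, false) s).1 = 1 -> uniq (right_ends (build s)).
Proof.
elim/last_ind: s => // s x IHs s1 _.
have s1' y : y \in s -> y.1 <= 1 by move=> ys; apply: s1;
  rewrite mem_rcons inE ys orbT.
have x1 : x.1 <= 1 by apply: s1; rewrite mem_rcons mem_head.
have [->|nil] := eqVneq s [::]; first by rewrite /= => ->.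
rewrite (_ : head _ _ = head (0, false) s); last by case: (s) nil.
move=> /(IHs s1' (elimN eqP nil)) un; have [sz cnt] := build_inv s1'.
have lt_fresh z : z \in right_ends (build s) -> z < fresh (build s).
  by rewrite -has_pred1 has_count; have := cnt z; case: ltnP => //; lia.
rewrite build_rcons /=.
case: (right_ends (build s)) sz un lt_fresh => [|e1 [|e2 [|e3 [|e4 [|]]]]] //.
move=> _ un lt.
have in4 e : e \in [:: e1; e2; e3; e4]
    = [|| e == e1, e == e2, e == e3 | e == e4].
  by rewrite !inE.
have := lt e1; have := lt e2; have := lt e3; have := lt e4.
rewrite !in4 !eqxx !orbT /= => /(_ isT) l4 /(_ isT) l3 /(_ isT) l2 /(_ isT) l1.
move: un; case: (x.1) x1 => [|[|//]] _ /=; rewrite !inE; lia.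
Qed.
End Build.

Definition all_labels (D : diagram) : seq nat := flatten [seq val x | x <- D].

Lemma card_edge (D : diagram) y :
  #|[pred q : end_of D | edge q == y]| = count_mem y (all_labels D).
Proof.
rewrite -sum1_card big_mkcond /= -(pair_bigA _ (fun c k =>
  if edge ((c, k) : end_of D) == y then 1 else 0)) /=.
rewrite count_flatten sumnE !big_map [RHS]big_tnth; apply: eq_bigr => c _.
rewrite -sum1_count big_tuple -big_mkcond; apply: eq_bigl => k.
by rewrite /edge /= !(tnth_nth 0) /=.
Qed.

(** Both closures on the right have this form, for two pairings of the ends. *)
Definition glue (e e' f f' x : nat) : nat :=
  if x == e' then e else if x == f' then f else x.

Lemma count_glue (L : seq nat) e e' f f' :
  uniq [:: e; e'; f; f'] ->
  (forall z, z \in [:: e; e'; f; f'] -> count_mem z L = 1) ->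
  (forall z, z \in L -> z \notin [:: e; e'; f; f'] -> count_mem z L = 2) ->
  forall z, z \in L -> count (fun x => glue e e' f f' x == glue e e' f f' z) L
    = 2.
Proof.
move=> un one two z zL.
have count2 u w : u != w ->
    count (fun x => (x == u) || (x == w)) L = count_mem u L + count_mem w L.
  move=> uw; rewrite -count_predUI [X in _ + X](_ : _ = 0) ?addn0 //.
  apply/eqP; rewrite -leqn0 leqNgt -has_count; apply/hasPn => x _ /=.
  by apply/negP => /andP[/eqP-> /eqP e0]; rewrite e0 eqxx in uw.
have [ze|ze] := boolP (z \in [:: e; e'; f; f']); last first.
  rewrite -[RHS](two z) //; apply: eq_count => x /=.
  move: ze un; rewrite /glue /= !inE.
  by case: (x =P e'); case: (x =P f'); case: (z =P e'); case: (z =P f'); lia.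
have [l1 l2 l3 l4] : [/\ count_mem e L = 1, count_mem e' L = 1,
    count_mem f L = 1 & count_mem f' L = 1].
  by split; apply: one; rewrite !inE eqxx ?orbT.
have /orP[gz|gz] : (glue e e' f f' z == e) || (glue e e' f f' z == f).
  by move: ze; rewrite /glue !inE; case: (z =P e'); case: (z =P f'); lia.
- rewrite (eqP gz) -[RHS]/(1 + 1) -{1}l1 -l2 -count2; last by move: un;
  rewrite /= !inE; lia.
  apply: eq_count => x; move: un; rewrite /glue /= !inE.
  by case: (x =P e'); case: (x =P f'); lia.
- rewrite (eqP gz) -[RHS]/(1 + 1) -{1}l3 -l4 -count2; last by move: un;
  rewrite /= !inE; lia.
  apply: eq_count => x; move: un; rewrite /glue /= !inE.
  by case: (x =P e'); case: (x =P f'); lia.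
Qed.

(** Enumerating a circle: it is enough to exhibit the other end of each edge. *)
Lemma closed_same (D : diagram) (v : smoothing D) (Z : pred (end_of D)) :
  edges_twice D ->
  (forall c k, Z (c, k) -> Z (c, arc_end (v c) k)) ->
  (forall p, Z p -> exists q, [/\ q != p, edge q = edge p & Z q]) ->
  forall p q, same_circle v p q -> Z p -> Z q.
Proof.
move=> D2 Zarc Zedge p q pq; apply/implyP.
move: p q pq; apply: (same_ind (R := fun p q => Z p ==> Z q)).
- by move=> p; apply: implybb.
- by move=> q p r /implyP pq /implyP qr; apply/implyP => /pq/qr.
- move=> p q pq; apply/implyP => Zp; have [r [nrp rp Zr]] := Zedge p Zp.
  have [->//|nqp] := eqVneq q p.
  by rewrite (edge_mate_uniq D2 (esym pq) nqp) -(edge_mate_uniq D2 rp nrp).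
- by move=> c k; apply/implyP/Zarc.
Qed.

Section Rational.
Variables (m : nat) (a : nat -> int).
Hypotheses (m_ge2 : 2 <= m) (a_neq0 : forall i, 1 <= i <= m -> (a i != 0)%R).
Let pr := program m a.
Let D := rational_diagram m a.
Let pr1 : forall x, x \in pr -> x.1 <= 1 := @program_pos m a.
Let R := right_at pr.
Let caps := right_caps m (R (size pr)).

Lemma size_rational : size D = size pr.
Proof. by rewrite size_map twistedE size_build. Qed.

(** The label of the strand in position [x] just before the crossing [j]. *)
Definition cut j x := caps (nth 0 (R j) x).

Lemma right_at_size : R (size pr) = right_ends (build pr).
Proof. by rewrite /R /right_at take_size. Qed.

Lemma edgeE (c : crossing_of D) k : edge ((c, k) : end_of D) =
  nth 0 [seq caps x | x <- crossing_labels (nth (0, false) pr c) (R c) c] k.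
Proof.
have lt_c : c < size pr by rewrite -size_rational.
rewrite /edge /= (tnth_nth 0) (tnth_nth (map_tuple caps [tuple 0; 0; 0; 0])) /=.
rewrite (nth_map [tuple 0; 0; 0; 0]) ?twistedE ?size_build // -right_at_size /=.
by rewrite -(nth_build [tuple 0; 0; 0; 0] lt_c).
Qed.

Lemma start_lt j : j < m -> size (program j a) < size (program j.+1 a).
Proof.
move=> lt_jm; rewrite programS size_cat size_nseq -[X in X < _]addn0 ltn_add2l.
by rewrite absz_gt0 a_neq0.
Qed.

Lemma start_le j : j <= m -> size (program j a) <= size pr.
Proof. by move=> /(program_prefix a)[s]; rewrite /pr => ->;
  rewrite size_cat leq_addr. Qed.

Lemma size_right_at c : size (R c) = 4.
Proof.
have [|//] := @build_inv (take c pr).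
by move=> x /mem_take/pr1.
Qed.

Lemma final_uniq : uniq (right_ends (build pr)).
Proof.
have lt0 : size (program 0 a) < size (program 1 a) by apply: start_lt;
  apply: ltnW.
have sz : 0 < size pr by apply: leq_trans lt0 (start_le (ltnW m_ge2)).
apply: right_ends_uniq => //; first by case: pr sz.
by rewrite -nth0 (@nth_program m a 0 0) ?(ltnW m_ge2).
Qed.

Lemma caps_glue : exists e1 e2 e3 e4, R (size pr) = [:: e1; e2; e3; e4] /\
  forall x, caps x = if odd m then glue e1 e2 e3 e4 x else glue e2 e3 e1 e4 x.
Proof.
rewrite /caps; case: (R (size pr)) (size_right_at (size pr)) => [|e1 [|e2 [|e3
  [|e4 [|]]]]] // _.
by exists e1, e2, e3, e4.
Qed.

(** Before closing, a label occurs twice among the crossings and the right ends.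
    The four right ends are distinct, so each of them occurs once among the
    crossings, and the closure identifies them in pairs. *)
Lemma rational_edges_twice : edges_twice D.
Proof.
move=> p; rewrite card_edge.
have labelsE : all_labels D = [seq caps x | x <- labels (build pr)].
  rewrite /all_labels /D /rational_diagram twistedE /labels -/pr -right_at_size.
  by rewrite -/caps; elim: (crossings _) => //= x s ->; rewrite map_cat.
have : edge p \in all_labels D.
  by rewrite -has_pred1 has_count -card_edge; apply/card_gt0P; exists p;
    rewrite inE.
rewrite labelsE => /mapP[z zL ->]; rewrite count_map.
have un := final_uniq; have [_ cnt] := build_inv pr1.
have [e1 [e2 [e3 [e4 [Re capsE]]]]] := caps_glue.
rewrite right_at_size in Re; rewrite Re in un cnt.
have one w : w \in [:: e1; e2; e3; e4] -> count_mem w (labels (build pr)) = 1.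
  by move=> wR; have := cnt w; rewrite (count_uniq_mem _ un) wR; lia.
have two w : w \in labels (build pr) -> w \notin [:: e1; e2; e3; e4] ->
    count_mem w (labels (build pr)) = 2.
  rewrite -has_pred1 has_count => wL nR; have := cnt w.
  by rewrite (count_uniq_mem _ un) (negPf nR); lia.
rewrite (eq_count (a2 := fun x => caps x == caps z)) //.
have [m_odd|m_even] := boolP (odd m).
  under eq_count => x do rewrite !capsE m_odd.
  exact: count_glue.
under eq_count => x do rewrite !capsE (negPf m_even).
have perm w : (w \in [:: e2; e3; e1; e4]) = (w \in [:: e1; e2; e3; e4]).
  by rewrite !inE; lia.
apply: count_glue => // [|w|w]; rewrite ?perm; auto.
by move: un; rewrite /= !inE; lia.
Qed.

(** Position 1 is used by all twist regions. The neighbours of the [i]-th region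
    twist it with this other position, which the [i]-th region does not touch.
    *)
Definition outer i := if odd i then 0 else 2.

Lemma cut_close : cut (size pr) 1 = cut (size pr) (outer m).
Proof.
have [e1 [e2 [e3 [e4 [Re capsE]]]]] := caps_glue.
have := final_uniq; rewrite -right_at_size /cut /outer !capsE Re /glue /= !inE.
by case: odd => /=; rewrite eqxx; do ![case: eqP]; lia.
Qed.

Lemma cut_start : cut 0 1 = cut 0 0.
Proof. by rewrite /cut /R /right_at take0. Qed.

Lemma cut_next c x : c < size pr ->
  let p := (nth (0, false) pr c).1 in
  cut c.+1 x = caps (if x == p then c.*2.+2 else if x == p.+1 then c.*2.+3
                     else nth 0 (R c) x).
Proof.
move=> lt_c p; rewrite /cut /R right_at_next //= nth_set_nth /= nth_set_nth /=.
congr caps; rewrite -/p; case: (x =P p.+1) => [->|_]; last by case: eqP.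
by rewrite gtn_eqF.
Qed.

Lemma edges_positive (c : crossing_of D) p : nth (0, false) pr c = (p, true) ->
  [/\ edge ((c, 0%R) : end_of D) = cut c p.+1,
      edge ((c, 1%R) : end_of D) = cut c.+1 p.+1,
      edge ((c, 2%R) : end_of D) = cut c.+1 p
    & edge ((c, 3%R) : end_of D) = cut c p].
Proof.
have lt_c : c < size pr by rewrite -size_rational.
move=> prc; rewrite !cut_next // !edgeE prc /= !eqxx.
by rewrite gtn_eqF.
Qed.

Lemma edges_negative (c : crossing_of D) p : nth (0, false) pr c = (p, false) ->
  [/\ edge ((c, 0%R) : end_of D) = cut c p,
      edge ((c, 1%R) : end_of D) = cut c p.+1,
      edge ((c, 2%R) : end_of D) = cut c.+1 p.+1
    & edge ((c, 3%R) : end_of D) = cut c.+1 p].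
Proof.
have lt_c : c < size pr by rewrite -size_rational.
move=> prc; rewrite !cut_next // !edgeE prc /= !eqxx.
by rewrite gtn_eqF.
Qed.

Let t : smoothing D := [ffun => true].
Let D2 : edges_twice D := rational_edges_twice.
Let edge2 (c : crossing_of D) (k : 'I_4) := edge ((c, k) : end_of D).

Lemma crossing_at c : c < size pr -> exists d : crossing_of D, d = c :> nat.
Proof. by rewrite -size_rational => lt_c; exists (Ordinal lt_c). Qed.

Let t_arc (c : crossing_of D) : t c = true. Proof. by rewrite ffunE. Qed.

Lemma arcs_true : [/\ arc_end true 0 = 3, arc_end true 1 = 2, arc_end true 2 = 1
  & arc_end true 3 = 0 :> 'I_4]%R.
Proof. by split; apply/eqP. Qed.

Section Bigon.
Variables (d e : crossing_of D) (p : nat).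
Hypotheses (de : e = d.+1 :> nat) (prd : nth (0, false) pr d = (p, true))
  (pre : nth (0, false) pr e = (p, true)).
Let nde : (d == e) = false.
Proof. by rewrite -val_eqE /= de ltn_eqF. Qed.

Lemma bigon_edges : edge2 d 1%R = edge2 e 0%R /\ edge2 d 2%R = edge2 e 3%R.
Proof.
have [_ d1 d2 _] := edges_positive prd; have [e0 _ _ e3] := edges_positive pre.
by rewrite /edge2 d1 d2 e0 e3 de.
Qed.

(** The circle enclosed by two consecutive crossings of a positive region. *)
Lemma bigon_circle q : same_circle t (e, 0%R) q ->
  q \in [:: (e, 0%R); (e, 3%R); (d, 1%R); (d, 2%R)].
Proof.
have [E1 E2] := bigon_edges; have [A0 A1 A2 A3] := arcs_true.
have ned : (e == d) = false by rewrite eq_sym.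
move=> eq; pose Z (r : end_of D) := r \in [:: (e, 0%R); (e, 3%R); (d, 1%R);
  (d, 2%R)].
suff: Z q by []; apply: (closed_same (Z := Z) D2 _ _ eq);
  last by rewrite /Z inE eqxx.
- move=> c k; rewrite /Z !inE !xpair_eqE t_arc.
  by case: (ord4P k) => ->;
    rewrite ?A0 ?A1 ?A2 ?A3 /= ?andbT ?andbF ?orbF //= ?orbT => ->.
- move=> r; rewrite {1}/Z !inE => /or4P[] /eqP->.
  + by exists (d, 1%R); rewrite /Z !inE !xpair_eqE nde !eqxx; split.
  + by exists (d, 2%R); rewrite /Z !inE !xpair_eqE nde !eqxx ?orbT; split.
  + by exists (e, 0%R); rewrite /Z !inE !xpair_eqE ned !eqxx; split.
  + by exists (e, 3%R); rewrite /Z !inE !xpair_eqE ned !eqxx ?orbT; split.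
Qed.

Lemma bigon_right_noloop : ~~ same_circle t (e, 0%R) (e, 1%R).
Proof.
apply/negP => /bigon_circle; rewrite !inE !xpair_eqE [e == d]eq_sym nde.
by rewrite /= !andbF.
Qed.

Lemma bigon_left_noloop : ~~ same_circle t (d, 0%R) (d, 1%R).
Proof.
apply/negP; rewrite sameC => h; have [E1 _] := bigon_edges.
have := bigon_circle (same_trans (same_edge t (esym E1)) h).
by rewrite !inE !xpair_eqE nde /= !andbF.
Qed.
End Bigon.

Section Region.
Variable j : nat.
Hypothesis lt_jm : j < m.
Let b := size (program j a).
Let n := `|a j.+1|%N.
Let od := odd j.+1.
Let posn : nat := if od then 1 else 0.
Let u := if od then 0 else 2.

Lemma region_end : size (program j.+1 a) = b + n.
Proof. by rewrite programS size_cat size_nseq. Qed.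

Let n_gt0 : 0 < n.
Proof. by rewrite absz_gt0 a_neq0. Qed.

Lemma region_le : b + n <= size pr.
Proof. by rewrite -region_end; apply: start_le. Qed.

Lemma nth_region c : b <= c < b + n ->
  nth (0, false) pr c = (posn, (0 < a j.+1)%R).
Proof. by rewrite -region_end; apply: nth_program. Qed.

(** The outer strand runs along the whole region. *)
Lemma cut_outer k : k <= n -> cut (b + k) u = cut b u.
Proof.
elim: k => [|k IHk] lt_kn; first by rewrite addn0.
have bk : b <= b + k < b + n by rewrite leq_addr ltn_add2l.
rewrite -IHk 1?ltnW // addnS cut_next; last first.
  by apply: leq_trans region_le; rewrite ltn_add2l.
by rewrite (nth_region bk) /= /u /posn; case: od.
Qed.

Lemma start_first : j = 0 -> cut b 1 = cut b u.
Proof. by move=> j0; rewrite /b /u /od j0; apply: cut_start. Qed.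

Lemma end_last : j.+1 = m -> cut (b + n) 1 = cut (b + n) u.
Proof.
move=> jm; rewrite -region_end jm cut_close.
by rewrite /u /od jm.
Qed.

Hypothesis left_pos : 0 < j -> (0 < a j)%R.
Hypothesis right_pos : j.+1 < m -> (0 < a j.+2)%R.

(** The last crossing of the previous region. *)
Lemma left_neighbour : 0 < j -> exists2 d : crossing_of D, d.+1 = b &
  nth (0, false) pr d = (if od then 0 else 1, true).
Proof.
move=> j0; have jE : j = j.-1.+1 by rewrite prednK.
have lt_j1m : j.-1 < m by rewrite -ltnS -jE ltnS ltnW.
have lt : size (program j.-1 a) < b by have := start_lt lt_j1m; rewrite -jE.
have b0 : 0 < b by apply: leq_ltn_trans lt.
have [|d dE] := @crossing_at b.-1.
  by rewrite prednK // (leq_trans _ region_le) // leq_addr.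
exists d; first by rewrite dE prednK.
rewrite dE (@nth_program m a j.-1) //; last first.
  by rewrite -jE -/b; lia.
by rewrite -jE left_pos // /od /=; case: odd.
Qed.

(** The first crossing of the next region. *)
Lemma right_neighbour : j.+1 < m ->
  exists2 d : crossing_of D, d = b + n :> nat &
  nth (0, false) pr d = (if od then 0 else 1, true).
Proof.
move=> lt_j1m; have lt := start_lt lt_j1m; rewrite region_end in lt.
have [|d dE] := @crossing_at (b + n).
  by apply: leq_trans lt _; apply: start_le.
exists d => //; rewrite dE (@nth_program m a j.+1) //; last first.
  by rewrite region_end leqnn lt.
by rewrite right_pos // /od /=; case: odd.
Qed.

(** The right end in position 1 of a positive crossing of a neighbouring region
    is [kr1 od], and its right end on the outer strand is [kr1 (~~ od)].
    Likewise [kl1] gives the left ends. *)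
Definition kr1 (x : bool) : 'I_4 := (if x then 1 else 2)%R.
Definition kl1 (x : bool) : 'I_4 := (if x then 0 else 3)%R.

Lemma neighbour_edges (d : crossing_of D) :
  nth (0, false) pr d = (if od then 0 else 1, true) ->
  [/\ edge2 d (kr1 od) = cut d.+1 1, edge2 d (kr1 (~~ od)) = cut d.+1 u,
      edge2 d (kl1 od) = cut d 1 & edge2 d (kl1 (~~ od)) = cut d u].
Proof. by move=> /edges_positive[]; rewrite /edge2 /kr1 /kl1 /u; case: od. Qed.

Lemma same_arc_kr (d : crossing_of D) x y : same_circle t (d, kr1 x) (d, kr1 y).
Proof.
have h : same_circle t (d, 1%R) (d, 2%R) by apply: same_12; rewrite ffunE.
by case: x; case: y; rewrite ?same_refl // sameC.
Qed.

Lemma same_arc_kl (d : crossing_of D) x y : same_circle t (d, kl1 x) (d, kl1 y).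
Proof.
have h : same_circle t (d, 0%R) (d, 3%R) by apply: same_03; rewrite ffunE.
by case: x; case: y; rewrite ?same_refl // sameC.
Qed.

Definition label_same x y :=
  forall p q : end_of D, edge p = x -> edge q = y -> same_circle t p q.

Lemma label_same_refl x : label_same x x.
Proof. by move=> p q px qx; apply: same_edge; rewrite px. Qed.

Lemma label_same_via (p q : end_of D) : same_circle t p q ->
  label_same (edge p) (edge q).
Proof.
move=> pq r s rp sq; apply: same_trans (same_edge t rp) _.
by apply: same_trans pq _; apply: same_edge.
Qed.

Lemma label_sameC x y : label_same x y -> label_same y x.
Proof. by move=> xy p q py qx; rewrite sameC; apply: xy. Qed.

Lemma label_same_trans (r : end_of D) x y : label_same x (edge r) ->
  label_same (edge r) y ->
  label_same x y.
Proof. by move=> xr ry p q px qy;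
  apply: same_trans (xr p r px _) (ry r q _ qy). Qed.

(** On its left, the strand in position 1 is turned onto the outer strand by the
    vertical arc of the previous region, or by the left cap. *)
Lemma left_same : label_same (cut b 1) (cut b u).
Proof.
have [j0|j0] := posnP j; first by rewrite start_first //;
  apply: label_same_refl.
have [d db /neighbour_edges[E1 E2 _ _]] := left_neighbour j0.
by rewrite -db -E1 -E2; apply/label_same_via/same_arc_kr.
Qed.

Lemma right_same : label_same (cut (b + n) 1) (cut (b + n) u).
Proof.
have [lt_j1m|ge_j1m] := ltnP j.+1 m; last first.
  have jm : j.+1 = m by apply/eqP; rewrite eqn_leq lt_jm.
  by rewrite end_last //; apply: label_same_refl.
have [d db /neighbour_edges[_ _ E1 E2]] := right_neighbour lt_j1m.
by rewrite -db -E1 -E2; apply/label_same_via/same_arc_kl.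
Qed.

Lemma outer_end : exists r : end_of D, edge r = cut b u.
Proof.
have [j0|j0] := posnP j; last first.
  have [d db /neighbour_edges[_ E2 _ _]] := left_neighbour j0.
  by exists (d, kr1 (~~ od)); rewrite -db -E2.
have [|d db /neighbour_edges[_ _ _ E2]] := right_neighbour; first by rewrite j0.
by exists (d, kl1 (~~ od)); rewrite -(cut_outer (leqnn n)) -db -E2.
Qed.

(** The leftmost and rightmost arcs of a positive region are on the same circle,
    through the outer strand. *)
Lemma region_closes : label_same (cut (b + n) 1) (cut b 1).
Proof.
have [r rE] := outer_end.
apply: (@label_same_trans r); rewrite rE.
  by rewrite -(cut_outer (leqnn n)); apply: right_same.
exact/label_sameC/left_same.
Qed.

Section Negative.
Hypothesis a_neg : ~~ (0 < a j.+1)%R.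

Let kL : 'I_4 := (if od then 0 else 1)%R.
Let kR : 'I_4 := (if od then 3 else 2)%R.

(** The circle that contains the strand in position 1 of a negative region: this
    strand, of ends [kL] and [kR], and the arcs of the two neighbouring
    crossings, which turn it onto the outer strand on both sides. *)
Definition inner_circle : pred (end_of D) := [pred q : end_of D |
  [|| (b <= q.1 < b + n) && (q.2 \in [:: kL; kR]),
      (q.1.+1 == b) && (q.2 \in [:: kr1 od; kr1 (~~ od)])
    | (q.1 == b + n :> nat) && (q.2 \in [:: kl1 od; kl1 (~~ od)])]].
Let Z := inner_circle.

Lemma strand_edges (c : crossing_of D) : b <= c < b + n ->
  edge2 c kL = cut c 1 /\ edge2 c kR = cut c.+1 1.
Proof.
move=> /nth_region; rewrite (negPf a_neg) => /edges_negative[].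
by rewrite /edge2 /kL /kR /posn; case: od.
Qed.

Lemma left_left_end (p : end_of D) : p.1 != b.-1 :> nat -> 0 < j -> exists q,
  [/\ q != p, edge q = cut b 1 & Z q].
Proof.
move=> pb j0; have [d db /neighbour_edges[E1 _ _ _]] := left_neighbour j0.
exists (d, kr1 od); split; last by apply/or3P; constructor 2;
  rewrite /= db !inE !eqxx.
  by apply: contra pb => /eqP <- /=; rewrite -db.
by rewrite -db.
Qed.

Lemma left_outer_end (p : end_of D) : p.1 != b.-1 :> nat -> 0 < j -> exists q,
  [/\ q != p, edge q = cut b u & Z q].
Proof.
move=> pb j0; have [d db /neighbour_edges[_ E1 _ _]] := left_neighbour j0.
exists (d, kr1 (~~ od)); split; last by apply/or3P; constructor 2;
  rewrite /= db !inE !eqxx orbT.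
  by apply: contra pb => /eqP <- /=; rewrite -db.
by rewrite -db.
Qed.

Lemma right_right_end (p : end_of D) : p.1 != b + n :> nat -> j.+1 < m ->
  exists q,
  [/\ q != p, edge q = cut (b + n) 1 & Z q].
Proof.
move=> pb j0; have [d db /neighbour_edges[_ _ E1 _]] := right_neighbour j0.
exists (d, kl1 od); split; last by apply/or3P; constructor 3;
  rewrite /= db !inE !eqxx.
  by apply: contra pb => /eqP <- /=; rewrite -db.
by rewrite -db.
Qed.

Lemma right_outer_end (p : end_of D) : p.1 != b + n :> nat -> j.+1 < m ->
  exists q,
  [/\ q != p, edge q = cut b u & Z q].
Proof.
move=> pb j0; have [d db /neighbour_edges[_ _ _ E1]] := right_neighbour j0.
exists (d, kl1 (~~ od)); split; last by apply/or3P; constructor 3;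
  rewrite /= db !inE !eqxx orbT.
  by apply: contra pb => /eqP <- /=; rewrite -db.
by rewrite -(cut_outer (leqnn n)) -db.
Qed.

Lemma strand_left_end (p : end_of D) c : b <= c < b + n -> p.1 != c :> nat ->
  exists q, [/\ q != p, edge q = cut c 1 & Z q].
Proof.
move=> cb pc; have [|d dc] := @crossing_at c.
  by case/andP: cb => _ /leq_trans; apply; apply: region_le.
rewrite -dc in cb pc *; have [E1 E2] := strand_edges cb.
exists (d, kL); split=> //; last by apply/or3P; constructor 1;
  rewrite /= cb !inE eqxx.
by apply: contra pc => /eqP <-.
Qed.

Lemma strand_right_end (p : end_of D) c : b <= c < b + n -> p.1 != c :> nat ->
  exists q, [/\ q != p, edge q = cut c.+1 1 & Z q].
Proof.
move=> cb pc; have [|d dc] := @crossing_at c.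
  by case/andP: cb => _ /leq_trans; apply; apply: region_le.
rewrite -dc in cb pc *; have [E1 E2] := strand_edges cb.
exists (d, kR); split=> //; last by apply/or3P; constructor 1;
  rewrite /= cb !inE eqxx orbT.
by apply: contra pc => /eqP <-.
Qed.

Lemma b_start : j = 0 -> b = 0.
Proof. by rewrite /b => ->. Qed.

(** Following each edge of this circle to its other end.  When the region is the
    first or the last, a cap replaces the arc of the missing neighbour. *)
Lemma inner_circle_edge (p : end_of D) : Z p ->
  exists q, [/\ q != p, edge q = edge p & Z q].
Proof.
have nE : (b + n).-1.+1 = b + n by rewrite prednK // addn_gt0 n_gt0 orbT.
have last_in : b <= (b + n).-1 < b + n by rewrite nE leqnn andbT -ltnS nE
  -addn1 leq_add2l.
have first_in : b <= b < b + n by rewrite leqnn -[X in X < _]addn0 ltn_add2l.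
have jm : ~~ (j.+1 < m) -> j.+1 = m.
  by rewrite -leqNgt => ge; apply/eqP; rewrite eqn_leq lt_jm.
have j_gt0 : ~~ (j.+1 < m) -> 0 < j by move=> /jm e; rewrite -ltnS e.
have j1m : ~~ (0 < j) -> j.+1 < m by rewrite -eqn0Ngt => /eqP->.
have b_gt0 : 0 < j -> 0 < b.
  by move=> j0; have [d <-] := left_neighbour j0.
have outerE := cut_outer (leqnn n).
have uE : ~~ (j.+1 < m) -> cut b u = cut (b + n) 1.
  by move=> /jm e; rewrite end_last.
have sE : ~~ (0 < j) -> cut b 1 = cut b u by rewrite -eqn0Ngt => /eqP;
  apply: start_first.
case: p => c k; case/or3P => /= /andP[cb]; rewrite !inE.
- have [le_bc lt_c] := andP cb; have [E1 E2] := strand_edges cb.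
  case/orP => /eqP kE; rewrite kE -/(edge2 _ _) ?E1 ?E2.
  + have [bc|bc] := eqVneq (c : nat) b.
      rewrite bc; have [j0|j0] := boolP (0 < j).
        by apply: left_left_end => //=; rewrite bc; have := b_gt0 j0; lia.
      rewrite sE //; apply: right_outer_end => /=; last exact: j1m.
      by rewrite bc; lia.
    have cE : c.-1.+1 = c by move: bc le_bc; lia.
    rewrite -cE; apply: strand_right_end => /=; last by lia.
    by move: bc cE; lia.
  + have [lt_c1|ge_c1] := ltnP c.+1 (b + n).
      by apply: strand_left_end => /=; lia.
    have -> : c.+1 = b + n by lia.
    have [lt|ge] := boolP (j.+1 < m).
      by apply: right_right_end => //=; lia.
    rewrite -uE //; apply: left_outer_end => /=; last exact: j_gt0.
    by have := b_gt0 (j_gt0 ge); lia.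
- have j0 : 0 < j.
    by case: posnP => // /b_start b0; rewrite b0 in cb.
  have [d db /neighbour_edges[E1 E2 _ _]] := left_neighbour j0.
  have cd : c = d by apply/val_inj/succn_inj; rewrite db; apply/eqP.
  case/orP => /eqP kE; rewrite kE -/(edge2 _ _) cd ?E1 ?E2 db.
    by apply: strand_left_end => //=; rewrite -db; lia.
  have [lt|ge] := boolP (j.+1 < m).
    by apply: right_outer_end => //=; rewrite -db; lia.
  rewrite uE // -nE; apply: strand_right_end => //=; rewrite -db; lia.
- have [lt|ge] := boolP (j.+1 < m); last first.
    have : c < size pr by rewrite -size_rational.
    by rewrite (eqP cb) -region_end (jm ge) ltnn.
  have [d db /neighbour_edges[_ _ E1 E2]] := right_neighbour lt.
  have cd : c = d by apply/val_inj; rewrite /= db; apply/eqP.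
  case/orP => /eqP kE; rewrite kE -/(edge2 _ _) cd ?E1 ?E2 db.
    by rewrite -[in cut _ _]nE; apply: strand_right_end => //=; rewrite db; lia.
  rewrite outerE; have [j0|j0] := boolP (0 < j).
    by apply: left_outer_end => //=; rewrite db; lia.
  rewrite -sE //; apply: strand_left_end => //=; rewrite db; lia.
Qed.

(** The circle of one horizontal strand does not contain the other one. *)
Lemma negative_noloop (c : crossing_of D) : b <= c < b + n ->
  ~~ same_circle t (c, 0%R) (c, 1%R).
Proof.
move=> cb; have [A0 A1 A2 A3] := arcs_true.
have Zarc d k : Z (d, k) -> Z (d, arc_end (t d) k).
  rewrite t_arc /Z /inner_circle /= !inE /kr1 /kl1 /kL /kR.
  by case: (ord4P k) => ->; rewrite ?A0 ?A1 ?A2 ?A3; case: od.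
have notin (k : 'I_4) : k \notin [:: kL; kR] -> Z (c, k) = false.
  move=> kZ; rewrite /Z /inner_circle /= (negPf kZ) andbF /=.
  have [le lt] := andP cb.
  by rewrite [c.+1 == b]gtn_eqF // [_ == b + n]ltn_eqF.
have isin (k : 'I_4) : k \in [:: kL; kR] -> Z (c, k).
  by move=> kZ; rewrite /Z /inner_circle /= kZ cb.
apply/negP => h; have := closed_same D2 Zarc inner_circle_edge h.
have := closed_same D2 Zarc inner_circle_edge (etrans (sameC _ _ _) h).
have := @isin kL; have := @notin (if od then 1%R else 0%R).
rewrite /kL /kR; case: od => /(_ isT) n1 /(_ isT) i1;
  first by move=> _ /(_ i1); rewrite n1.
by move=> /(_ i1); rewrite n1.
Qed.
End Negative.

End Region.
End Rational.

Local Open Scope ring_scope.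

(** * Torsion of rational links *)

(** Here and below [j] stands for the entry [a j.+1]. *)
Definition positive_around (m : nat) (a : nat -> int) (j : nat) :=
  ((0 < j)%N -> 0 < a j) /\ ((j.+1 < m)%N -> 0 < a j.+2).

(** A crossing of a positive region meets the small circle that it forms with
    the next or the previous crossing of the region, which exists because the
    entry is not 1. *)
Lemma rational_adequate (m : nat) (a : nat -> int) : (2 <= m)%N ->
  (forall i, (1 <= i <= m)%N -> a i != 0) ->
  (forall i, (1 <= i <= m)%N -> a i != 1) ->
  (forall j, (j < m)%N -> a j.+1 < 0 -> positive_around m a j) ->
  forall c : crossing_of (rational_diagram m a),
  ~~ same_circle [ffun => true] (c, 0) (c, 1).
Proof.
move=> m2 a0 a1 neg c; have lt_c :
  (c < size (program m a))%N by rewrite -size_rational.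
have [j lt_jm jc] := program_region lt_c.
have [a_pos|a_npos] := boolP (0 < a j.+1); last first.
  have [|hl hr] := neg j lt_jm; first by have := a0 j.+1 lt_jm; lia.
  by apply: (negative_noloop m2 a0 lt_jm) => //; rewrite -region_end.
have n2 : (2 <= `|a j.+1|)%N by have := a0 j.+1 lt_jm; have := a1 j.+1 lt_jm;
  lia.
rewrite region_end in jc; have endj := region_le a lt_jm.
set b := size (program j a) in jc endj; set n := `|a j.+1|%N in n2 jc endj.
have nthj k : (b <= k < b + n)%N -> nth (0%N, false) (program m a) k =
    ((if odd j.+1 then 1 else 0)%N, true).
  by move=> bk; rewrite (nth_region lt_jm bk) a_pos.
have [lt_c1|ge_c1] := ltnP c.+1 (b + n).
  have [|d dE] := @crossing_at m a c.+1; first exact: leq_trans endj.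
  apply: (bigon_left_noloop m2 a0 dE); apply: nthj => //.
  by rewrite dE lt_c1 andbT ltnW // ltnS; case/andP: jc.
have [|d dE] := @crossing_at m a c.-1;
  first by rewrite (leq_ltn_trans (leq_pred c)).
have cd : c = d.+1 :> nat by rewrite dE; lia.
apply: (bigon_right_noloop m2 a0 cd); apply: nthj => //; lia.
Qed.

Lemma rational_polygon_torsion (m : nat) (a : nat -> int) (j : nat)
  (o : {ffun end_of (rational_diagram m a) -> bool}) : (2 <= m)%N ->
  (forall i, (1 <= i <= m)%N -> a i != 0) ->
  (forall i, (1 <= i <= m)%N -> a i != 1) ->
  (forall j, (j < m)%N -> a j.+1 < 0 -> positive_around m a j) ->
  (j < m)%N -> 3 <= a j.+1 -> positive_around m a j ->
  exists (h q : int) (x : Kh o h q), x != 0 /\ x *+ 2 = 0.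
Proof.
move=> m2 a0 a1 neg lt_jm a3 [hl hr];
  have adequate := rational_adequate m2 a0 a1 neg.
have a_pos : 0 < a j.+1 by lia.
have endj := region_le a lt_jm; have nthj := @nth_region m a j lt_jm.
have closes := region_closes m2 a0 lt_jm hl hr.
have D2 := rational_edges_twice m2 a0; have sizeD := size_rational m a.
move: endj nthj closes.
set b := size (program j a); set n := `|a j.+1|%N => endj nthj closes.
have n3 : (3 <= n)%N by rewrite /n; lia.
have [x0 _] : exists d : crossing_of (rational_diagram m a), d = b :> nat.
  by apply: crossing_at; apply: leq_trans endj; lia.
pose c i : crossing_of (rational_diagram m a) := insubd x0 (b + i)%N.
have cE i : (i < n)%N -> c i = (b + i)%N :> nat.
  move=> lti; have lt_bi : (b + i < size (rational_diagram m a))%N.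
    by rewrite sizeD; apply: leq_trans endj; rewrite ltn_add2l.
  by rewrite /c val_insubd lt_bi.
have nthc i : (i < n)%N -> nth (0%N, false) (program m a) (c i) =
    ((if odd j.+1 then 1 else 0)%N, true).
  by move=> lti; rewrite cE // nthj ?a_pos // leq_addr ltn_add2l.
have cS i : (i.+1 < n)%N -> c i.+1 = (c i).+1 :> nat.
  by move=> lti; rewrite !cE ?addnS // ltnW.
have cyc i : (i < n)%N ->
    same_circle [ffun => true] (c i, 1) (c (i.+1 %% n)%N, 0).
  move=> lti; have [lt_i1|ge_i1] := ltnP i.+1 n.
    rewrite modn_small //; apply: same_edge.
    by have [] := bigon_edges (cS i lt_i1) (nthc i lti) (nthc i.+1 lt_i1).
  have iE : i.+1 = n by apply/eqP; rewrite eqn_leq lti.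
  have n0 : (0 < n)%N by apply: leq_trans n3.
  rewrite iE modnn; set v : smoothing _ := [ffun => true].
  have s12 : same_circle v (c i, 1) (c i, 2) by apply: same_12; rewrite ffunE.
  have s03 : same_circle v (c 0%N, 0) (c 0%N, 3) by apply: same_03;
    rewrite ffunE.
  have [_ i1 i2 _] := edges_positive (nthc i lti).
  have [z0 _ _ z3] := edges_positive (nthc 0%N n0).
  rewrite cE // -addnS iE in i1 i2; rewrite cE // addn0 in z0 z3.
  move: i1 i2 z0 z3; case: odd => i1 i2 z0 z3.
    by apply: same_trans s12 _; rewrite (same_right _ s03); apply: closes.
  by apply: closes.
have small i p : (0 < i < n)%N ->
    same_circle [ffun => true] (c (i %% n)%N, 0) p ->
    p \in [:: (c i, 0); (c i, 3); (c i.-1, 1); (c i.-1, 2)].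
  case: i => // i /= lti; rewrite modn_small //.
  exact: (bigon_circle m2 a0 (cS i lti) (nthc i (ltnW lti)) (nthc i.+1 lti)).
have [n_odd|n_even] := boolP (odd n).
  exact: (odd_polygon_torsion o D2 adequate n3 cE cyc).
exact: (even_polygon_torsion o D2 adequate n3 cE cyc small).
Qed.

Theorem proposition20 (m : nat) (a : nat -> int)
  (a_neq0 : forall i : nat, (1 <= i <= m)%N -> a i != 0)
  (a_neq1 : forall i : nat, (1 <= i <= m)%N -> a i != 1)
  (large_entry :
    [\/ exists j : nat,
          [/\ (2 <= j <= m.-1)%N, 3 <= a j, 0 < a j.-1 & 0 < a j.+1],
        [/\ (2 <= m)%N, 3 <= a 1%N & 0 < a 2%N]
      | [/\ (2 <= m)%N, 3 <= a m & 0 < a m.-1]])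
  (negative_inner : forall i : nat, (2 <= i <= m.-1)%N -> a i < 0 ->
    0 < a i.-1 /\ 0 < a i.+1)
  (negative_first : a 1%N < 0 -> 0 < a 2%N)
  (negative_last : a m < 0 -> 0 < a m.-1)
  (o : {ffun end_of (rational_diagram m a) -> bool})
  (o_orientation : is_orientation o) :
  exists (h q : int) (x : Kh o h q), x != 0 /\ x *+ 2 = 0.
Proof.
have neg j : (j < m)%N -> a j.+1 < 0 -> positive_around m a j.
  move=> lt_jm aj; split=> [j0|lt_j1m].
    have [lt_j1m|ge] := ltnP j.+1 m.
      by have [] := negative_inner j.+1 _ aj => //; lia.
    have jm : j.+1 = m by apply/eqP; rewrite eqn_leq lt_jm.
    by move: negative_last; rewrite -jm; apply.
  have [j0|j0] := posnP j; first by rewrite j0 in aj *; apply: negative_first.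
  by have [] := negative_inner j.+1 _ aj => //; lia.
case: large_entry => [[[|j] [//= j_mid a3 al ar]]|[m2 a3 ar]|[m2 a3 al]].
- by apply: (@rational_polygon_torsion m a j) => //; lia.
- by apply: (@rational_polygon_torsion m a 0) => //; lia.
- have mE : m.-1.+1 = m by rewrite prednK // ltnW.
  apply: (@rational_polygon_torsion m a m.-1) => //; rewrite ?mE //.
  by split=> //; rewrite mE ltnn.
Qed.
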